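(* Let $r\ge 1$ and $n\ge 3r$ be integers with $n\not\equiv r\pmod 2$, and let $G$ be a connected graph with $n$ vertices and at most $r$ cycles. Then $$m'(G)\le c(n,r-1).$$ Equality can hold only if $G$ has precisely $r-1$ cycles, and equality holds if and only if $G\cong C(n,r-1)$.
   Context: All graphs are finite and simple. A maximum independent set is an independent set of vertices of largest cardinality among all independent sets of $G$; $m'(G)$ is the number of maximum independent sets of $G$. ''Number of cycles'' means the number of distinct cycle subgraphs. $\uplus$ is disjoint union, $tH$ is the disjoint union of $t$ copies of $H$ (empty if $t=0$), and $K_m$ is the complete graph. If $H$ is a graph all of whose components are complete, $K_m*H$ is the graph obtained from the disjoint union of $K_m$ and $H$ by picking a vertex $v_0$ of $K_m$ and joining it by an edge to exactly one vertex in each component of $H$. For $q\ge1$, $n\ge 3q$ and $n\equiv q\pmod 2$: $$C(n,q)=K_3*\Bigl((q-1)K_3\uplus\tfrac{n-3q}{2}K_2\Bigr),\qquad c(n,q)=3^{q-1}\cdot2^{(n-3q+2)/2}+2^{q-1}.$$ For $q=0$ and $n\ge2$ even: $$C(n,0)=K_1*\Bigl(K_1\uplus\tfrac{n-2}{2}K_2\Bigr),\qquad c(n,0)=2^{(n-2)/2}+1.$$ *)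

(* Defs.v *)
From mathcomp Require Import all_boot.

Set Implicit Arguments.
Unset Strict Implicit.
Unset Printing Implicit Defensive.

Record sgraph := SGraph {
  vertex :> finType;
  edge : rel vertex;
  edge_sym : symmetric edge;
  edge_irrefl : irreflexive edge }.

Definition connected (G : sgraph) : Prop := forall x y : G, connect (@edge G) x y.

Definition isomorphic (G H : sgraph) : Prop :=
  exists2 f : G -> H, bijective f & forall x y, edge (f x) (f y) = edge x y.

Definition independent (G : sgraph) (S : {set G}) : bool :=
  [forall x in S, forall y in S, ~~ edge x y].

Definition maximum_independent (G : sgraph) (S : {set G}) : bool :=
  independent S && [forall S' : {set G}, independent S' ==> (#|S'| <= #|S|)].

Definition num_mis (G : sgraph) : nat :=
  #|[set S : {set G} | maximum_independent S]|.

Definition cycle_edges (T : finType) (c : seq T) : {set {set T}} :=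
  [set [set x; next c x] | x in c].

(* A cycle subgraph has no isolated vertices, so it is determined by its edge
   set; a cyclic vertex sequence realises it up to rotation and reversal. The
   vertices of a cycle are distinct, so bounding its length loses nothing. *)
Definition is_cycle (G : sgraph) (F : {set {set G}}) : bool :=
  [exists k : 'I_#|G|.+1, exists c : k.-tuple G,
     [&& 2 < k, ucycleb (@edge G) c & F == cycle_edges c]].

Definition num_cycles (G : sgraph) : nat :=
  #|[set F : {set {set G}} | is_cycle F]|.

Definition complete_edge (m : nat) : rel 'I_m := fun i j => i != j.

Lemma complete_edge_sym m : symmetric (@complete_edge m).
Proof. by move=> i j; rewrite /complete_edge eq_sym. Qed.

Lemma complete_edge_irrefl m : irreflexive (@complete_edge m).
Proof. by move=> i; rewrite /complete_edge eqxx. Qed.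

Definition complete (m : nat) : sgraph :=
  SGraph (@complete_edge_sym m) (@complete_edge_irrefl m).

Definition disjoint_union_edge (G H : sgraph) : rel (G + H)%type :=
  fun u v => match u, v with
  | inl x, inl y => edge x y
  | inr x, inr y => edge x y
  | _, _ => false
  end.

Lemma disjoint_union_edge_sym G H : symmetric (@disjoint_union_edge G H).
Proof. by move=> [x|x] [y|y] //=; rewrite edge_sym. Qed.

Lemma disjoint_union_edge_irrefl G H : irreflexive (@disjoint_union_edge G H).
Proof. by move=> [x|x] /=; rewrite edge_irrefl. Qed.

Definition disjoint_union (G H : sgraph) : sgraph :=
  SGraph (@disjoint_union_edge_sym G H) (@disjoint_union_edge_irrefl G H).

Definition copies_edge (t : nat) (H : sgraph) : rel ('I_t * H)%type :=
  fun u v => (u.1 == v.1) && edge u.2 v.2.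

Lemma copies_edge_sym t H : symmetric (@copies_edge t H).
Proof. by move=> u v; rewrite /copies_edge eq_sym edge_sym. Qed.

Lemma copies_edge_irrefl t H : irreflexive (@copies_edge t H).
Proof. by move=> u; rewrite /copies_edge edge_irrefl andbF. Qed.

Definition copies (t : nat) (H : sgraph) : sgraph :=
  SGraph (@copies_edge_sym t H) (@copies_edge_irrefl t H).

(* K_m * H: the vertex v_0 is 0 : 'I_m, and the vertex chosen in each component
   of H is the representative [root] of that component. When the components of
   H are complete, other choices give an isomorphic graph. *)
Definition star_edge (m : nat) (H : sgraph) : rel ('I_m + H)%type :=
  fun u v => match u, v with
  | inl i, inl j => i != j
  | inr x, inr y => edge x y
  | inl i, inr x | inr x, inl i => (val i == 0) && roots (@edge H) x
  end.

Lemma star_edge_sym m H : symmetric (@star_edge m H).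
Proof.
move=> [i|x] [j|y]; rewrite /star_edge.
- by rewrite eq_sym.
- by [].
- by [].
- exact: edge_sym.
Qed.

Lemma star_edge_irrefl m H : irreflexive (@star_edge m H).
Proof.
move=> [i|x]; rewrite /star_edge; first by rewrite eqxx.
exact: edge_irrefl.
Qed.

Definition star (m : nat) (H : sgraph) : sgraph :=
  SGraph (@star_edge_sym m H) (@star_edge_irrefl m H).

(* Meaningful for n = q mod 2 with 3q <= n if q > 0, and 2 <= n if q = 0. *)
Definition extremal_graph (n q : nat) : sgraph :=
  if q == 0 then
    star 1 (disjoint_union (complete 1) (copies ((n - 2) %/ 2) (complete 2)))
  else
    star 3 (disjoint_union (copies (q - 1) (complete 3))
                           (copies ((n - 3 * q) %/ 2) (complete 2))).

Definition extremal_count (n q : nat) : nat :=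
  if q == 0 then 2 ^ ((n - 2) %/ 2) + 1
  else 3 ^ (q - 1) * 2 ^ ((n - 3 * q + 2) %/ 2) + 2 ^ (q - 1).

(* Main.v *)
Require Import Defs.
From mathcomp Require Import all_boot all_order all_algebra.
From mathcomp Require Import ring lra zify.

Set Implicit Arguments.
Unset Strict Implicit.
Unset Printing Implicit Defensive.

(** Put [q = r - 1]. Then [n] and [q] have the same parity and the graph has at
    most [q + 1] cycles, one more than the extremal graph.

    For arbitrary graphs, the best use of [b] cycles is a disjoint union of [b]
    triangles and of edges. A triangle multiplies the number of maximum
    independent sets by 3 and an edge multiplies it by 2, which gives
    3^b 2^((n - 3 b) / 2) if [n] and [b] have the same parity; otherwise one
    cycle is of no use. This is [gbound], and [mu_le_gbound] proves it by
    deleting a vertex that is not a cut vertex. Cycles enter through three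
    facts only: their number is monotone, it is superadditive on disjoint sets,
    and a vertex with [d] neighbours in a connected set closes at least [d - 1]
    new cycles ([ncyc_add_vertex]).

    For connected graphs the bound is [hbound n q = lam q * gbound n q + eps q].
    In the extremal graph the first summand counts the sets that avoid the
    centre and the second one those that contain it ([extremal_counts]). The
    induction is [connected_bounded]. If some vertex of degree at least three
    is not a cut vertex, deleting it destroys two cycles, and the two branches
    stay below the bound. Otherwise all vertices that are not cut vertices have
    degree at most two. Take the cut vertex [x] that leaves the largest
    component; the other components contain no cut vertex, so each is a leaf
    or closes a cycle through [x] ([last_cut_vertex], [pendant_structure]).
    Giving up [x] always gains one vertex in each of these pieces, by sliding an
    independent set along a path ([pendant_shift]). So [x] is never used if
    there are two of them, and then the general bound is small enough. If
    there is one piece [K], and the rest is [M], the count is at most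
    [mu K * mu M + mu (K minus N(x)) * avoiding M N(x)] ([mu_pendant]). Here
    [mu M] is bounded by induction. The number of sets that avoid a given
    vertex of [M] is at most [lam q * gbound #|M| q] ([avoiding_le]): either
    deleting the vertex destroys a cycle, or a neighbour of it is forced and
    disappears as well. For a leaf or a triangle the two summands add up to
    exactly the bound ([leaf_equality], [triangle_equality]); longer cycles stay
    below it. Without a cut vertex the graph is a cycle, where only the
    triangle and the pentagon reach the bound, and the pentagon is too small to
    matter for the theorem.

    Equality forces the same structure at each step. A graph attaining the
    bound is grown from an edge or a triangle by hanging edges and triangles on
    a centre ([extremal]), because the vertex to which the new piece is attached
    must be avoided as often as a centre, and [extremal_avoiding] shows that
    then it is one. The cliques can be peeled off in any order, so such a graph
    is determined by [n] and [q] ([extremal_unique]), and C(n, q) is one of them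
    ([extremal_graph_extremal]). The hung cliques are joined by bridges, so it
    has at most [q] cycles ([extremal_ncyc]); it cannot have fewer, since the
    bound for fewer cycles is smaller ([few_cycles_strict]). *)

(** * Maximum independent sets of induced subgraphs *)

Section MaximumIndependentSets.
Variable G : sgraph.
Implicit Types (A B C K M R S U W : {set G}) (u v w x y z : G).

Definition nbrs A x := [set y in A | edge x y].

(** Locked so that membership unfolds through [misP] only. *)
Definition mis A := locked [set S : {set G} | [&& independent S, S \subset A &
  [forall S' : {set G}, independent S' && (S' \subset A) ==> (#|S'| <= #|S|)]]].

Definition mu A := #|mis A|.

(** The count is over the maximum independent sets of the whole of [A], so it
    vanishes when every one of them meets [U]. *)
Definition avoiding A U := #|[set S in mis A | [disjoint S & U]]|.

Definition separated A B := [disjoint A & B] /\ forall x y, x \in A -> y \in B -> ~~ edge x y.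

Lemma in_nbrs A x y : (y \in nbrs A x) = (y \in A) && edge x y.
Proof. by rewrite inE. Qed.

Lemma independentP S :
  reflect (forall x y, x \in S -> y \in S -> ~~ edge x y) (independent S).
Proof.
apply: (iffP forall_inP) => [H x y xS yS|H x xS].
  by have /forall_inP/(_ y yS) := H x xS.
by apply/forall_inP => y yS; apply: H.
Qed.

Lemma independentS S S' : S' \subset S -> independent S -> independent S'.
Proof.
move=> /subsetP sub /independentP H; apply/independentP => x y /sub xS /sub yS.
exact: H.
Qed.

Lemma independent0 : independent (set0 : {set G}).
Proof. by apply/independentP => x y; rewrite inE. Qed.

Lemma independentU1 S v :
  independent S -> (forall y, y \in S -> ~~ edge v y) -> independent (v |: S).
Proof.
move=> /independentP H Hv; apply/independentP => x y.
move=> /setU1P[->|xS] /setU1P[->|yS]; rewrite ?edge_irrefl //.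
- exact: Hv.
- by rewrite edge_sym; apply: Hv.
- exact: H.
Qed.

Lemma independentU S S' : independent S -> independent S' ->
  (forall x y, x \in S -> y \in S' -> ~~ edge x y) -> independent (S :|: S').
Proof.
move=> /independentP H /independentP H' HH; apply/independentP => x y.
move=> /setUP[xS|xS] /setUP[yS|yS]; [exact: H | exact: HH | | exact: H'].
by rewrite edge_sym; apply: HH.
Qed.

Lemma misP A S : reflect [/\ independent S, S \subset A
    & forall S', independent S' -> S' \subset A -> #|S'| <= #|S|] (S \in mis A).
Proof.
rewrite /mis -lock inE; apply: (iffP and3P) => -[H1 H2 H3]; split=> //.
  by move=> S' I' sub'; have /implyP := forallP H3 S'; apply; rewrite I'.
by apply/forallP => S'; apply/implyP => /andP[]; apply: H3.
Qed.

Lemma num_misE : num_mis G = mu [set: G].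
Proof.
rewrite /num_mis /mu; apply: eq_card => S; rewrite /mis -lock !inE subsetT /=.
rewrite /maximum_independent; congr andb.
by apply: eq_forallb => S'; rewrite subsetT andbT.
Qed.

Lemma mis_sub A S : S \in mis A -> S \subset A.
Proof. by case/misP. Qed.

Lemma mis_ind A S : S \in mis A -> independent S.
Proof. by case/misP. Qed.

Lemma mis_ex A : exists S, S \in mis A.
Proof.
have H0 : independent (set0 : {set G}) && (set0 \subset A).
  by rewrite independent0 sub0set.
pose P (S : {set G}) := independent S && (S \subset A).
case: (arg_maxnP (P := P) (fun S => #|S|) H0) => S /andP[I sub] Hmax.
by exists S; apply/misP; split=> // S' I' sub'; apply: Hmax; rewrite /P I'.
Qed.

Lemma mis_card A S S' : S \in mis A -> S' \in mis A -> #|S| = #|S'|.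
Proof.
case/misP=> I sub mx /misP[I' sub' mx']; apply/eqP.
by rewrite eqn_leq mx // mx'.
Qed.

Lemma mis_of_card A S S' : S \in mis A -> independent S' -> S' \subset A ->
  #|S| <= #|S'| -> S' \in mis A.
Proof.
case/misP=> I sub mx I' sub' le; apply/misP; split=> // S'' I'' sub''.
exact: leq_trans (mx _ I'' sub'') le.
Qed.

Lemma mis_restrict A B S : B \subset A -> S \subset B -> S \in mis A -> S \in mis B.
Proof.
move=> BA SB /misP[I sub mx]; apply/misP; split=> // S' I' sub'.
exact: mx I' (subset_trans sub' BA).
Qed.

Lemma mu0 : mu set0 = 1.
Proof.
rewrite /mu; have [S HS] := mis_ex set0.
apply/eqP/cards1P; exists S; apply/setP=> S'; rewrite in_set1.
apply/idP/eqP => [HS'|->//].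
by move: (mis_sub HS) (mis_sub HS'); rewrite !subset0 => /eqP-> /eqP->.
Qed.

Lemma mis1 v S : S \in mis [set v] -> S = [set v].
Proof.
case/misP=> _ sub mx; have := mx [set v]; rewrite subxx cards1 lt0n cards_eq0.
move=> H; apply/eqP; move: sub; rewrite subset1 => /orP[//|/eqP S0].
suff: S != set0 by rewrite S0 eqxx.
apply: H => //; apply/independentP => x y; rewrite !inE => /eqP-> /eqP->.
by rewrite edge_irrefl.
Qed.

Lemma mu1 v : mu [set v] = 1.
Proof.
have [S HS] := mis_ex [set v]; apply/eqP/cards1P; exists S; apply/setP=> S'.
rewrite in_set1; apply/idP/eqP => [HS'|->//].
by rewrite (mis1 HS) (mis1 HS').
Qed.

Lemma avoiding_le_mu A U : avoiding A U <= mu A.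
Proof. by apply/subset_leq_card/subsetP => S; rewrite !inE => /andP[]. Qed.

Lemma avoidingS A U W : U \subset W -> avoiding A W <= avoiding A U.
Proof.
move=> sub; apply/subset_leq_card/subsetP => S; rewrite !inE => /andP[->].
by move=> /(disjointWr sub)->.
Qed.

Lemma avoiding_mu A U : avoiding A U <= mu (A :\: U).
Proof.
apply/subset_leq_card/subsetP => S; rewrite inE => /andP[HS dis].
apply: mis_restrict (HS); first exact: subsetDl.
by rewrite subsetD dis andbT (mis_sub HS).
Qed.

Lemma card_leq_prod (P Q1 Q2 : {set {set G}}) (f1 f2 : {set G} -> {set G}) :
  (forall S, S \in P -> f1 S \in Q1) -> (forall S, S \in P -> f2 S \in Q2) ->
  {in P &, injective (fun S => (f1 S, f2 S))} ->
  #|P| <= #|Q1| * #|Q2|.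
Proof.
move=> H1 H2 inj; rewrite -cardsX -(card_in_imset inj).
by apply/subset_leq_card/subsetP => _ /imsetP[S SP ->]; rewrite inE /= H1 //= H2.
Qed.

Lemma mu_split A v : mu A =
  #|[set S in mis A | v \notin S]| + #|[set S in mis A | v \in S]|.
Proof.
rewrite /mu -(cardsID [set S : {set G} | v \in S]) addnC.
by congr (_ + _); apply: eq_card => S; rewrite !inE // andbC.
Qed.

Lemma avoiding1E A v : avoiding A [set v] = #|[set S in mis A | v \notin S]|.
Proof.
apply: eq_card => S; rewrite !inE; congr andb.
by rewrite disjoint_sym disjoints1.
Qed.

Lemma mis_without A v S : S \in mis A -> v \notin S -> S \in mis (A :\ v).
Proof.
move=> HS vS; apply: mis_restrict (HS); first exact: subD1set.
by rewrite subsetD1 vS (mis_sub HS).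
Qed.

Lemma mis_with A v S : S \in mis A -> v \in S ->
  S :\ v \in mis (A :\: (v |: nbrs A v)).
Proof.
case/misP=> I sub mx vS; apply/misP; split.
- exact: independentS (subD1set _ _) I.
- apply/subsetP => y; rewrite !inE => /andP[yv yS].
  rewrite (negPf yv) (subsetP sub) //=.
  by rewrite (independentP _ I).
- move=> S' I' sub'; rewrite -ltnS (cardsD1 v S) vS in mx *.
  have vS' : v \notin S' by apply/negP => /(subsetP sub'); rewrite !inE eqxx.
  have := mx (v |: S'); rewrite cardsU1 vS' !add1n; apply.
    apply: independentU1 I' _ => y /(subsetP sub'); rewrite !inE negb_or.
    by case/andP=> /andP[_]; rewrite negb_and => /orP[/negPf->|].
  rewrite subUset sub1set (subsetP sub) //=.
  exact: subset_trans sub' (subsetDl _ _).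
Qed.

Lemma mu_with A v : #|[set S in mis A | v \in S]| <= mu (A :\: (v |: nbrs A v)).
Proof.
rewrite -(card_in_imset (f := fun S => S :\ v)).
  apply/subset_leq_card/subsetP => _ /imsetP[S + ->].
  by rewrite inE => /andP[HS vS]; apply: mis_with.
move=> S S'; rewrite !inE => /andP[_ vS] /andP[_ vS'] E.
by rewrite -(setD1K vS) -(setD1K vS') E.
Qed.

Lemma mu_vertex A v : mu A <= mu (A :\ v) + mu (A :\: (v |: nbrs A v)).
Proof.
rewrite (mu_split A v) leq_add ?mu_with //.
apply/subset_leq_card/subsetP => S; rewrite inE => /andP[HS vS].
exact: mis_without.
Qed.

Lemma mis_sep A B S : B \subset A -> separated B (A :\: B) -> S \in mis A ->
  S :&: B \in mis B.
Proof.
move=> BA [_ sep] /misP[I sub mx]; apply/misP; split.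
- exact: independentS (subsetIl _ _) I.
- exact: subsetIr.
- move=> S' I' sub'.
  have dis : [disjoint S' & S :\: B].
    by apply: disjointWl sub' _; rewrite disjoint_sym disjoints_subset setDE subsetIr.
  have := mx (S' :|: (S :\: B)); rewrite cardsU (disjoint_setI0 dis) cards0 subn0.
  rewrite -(cardsID B S) leq_add2r; apply.
    apply: independentU I' (independentS (subsetDl _ _) I) _ => x y xS' yS.
    by apply: sep; rewrite ?(subsetP sub') //; apply: subsetP yS; apply: setSD.
  rewrite subUset (subset_trans sub' BA) /=.
  exact: subset_trans (subsetDl _ _) sub.
Qed.

Lemma separated_sym A B : separated A B -> separated B A.
Proof.
case=> dis sep; split=> [|x y xB yA]; first by rewrite disjoint_sym.
by rewrite edge_sym; apply: sep.
Qed.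

Lemma separatedC A B : B \subset A -> separated B (A :\: B) ->
  separated (A :\: B) (A :\: (A :\: B)).
Proof. by move=> BA /separated_sym; rewrite setDDr setDv set0U (setIidPr BA). Qed.

(** All maximum independent sets have equally many vertices in a separated
    part, so the parts inside and outside of it can be recombined. *)
Lemma mis_swap A B S S' : B \subset A -> separated B (A :\: B) ->
  S \in mis A -> S' \in mis A -> (S :\: B) :|: (S' :&: B) \in mis A.
Proof.
move=> BA sep HS HS'; have E := mis_card (mis_sep BA sep HS) (mis_sep BA sep HS').
apply: (mis_of_card HS).
- apply: independentU => [||x y].
  + exact: independentS (subsetDl _ _) (mis_ind HS).
  + exact: independentS (subsetIl _ _) (mis_ind HS').
  + rewrite !inE => /andP[xB xS] /andP[_ yB]; rewrite edge_sym.
    by apply: sep.2; rewrite // inE xB (subsetP (mis_sub HS)).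
- rewrite subUset (subset_trans (subsetDl _ _) (mis_sub HS)).
  exact: subset_trans (subsetIr _ _) BA.
- have dis : (S :\: B) :&: (S' :&: B) = set0.
    by apply/setP => x; rewrite !inE; case: (x \in B); rewrite ?andbF.
  by rewrite cardsU dis cards0 subn0 -E -[X in X <= _](cardsID B S) addnC.
Qed.

Lemma mu_sep A B : B \subset A -> separated B (A :\: B) ->
  mu A <= mu B * mu (A :\: B).
Proof.
move=> BA sep.
apply: (card_leq_prod (f1 := fun S => S :&: B) (f2 := fun S => S :&: (A :\: B))).
- by move=> S; apply: mis_sep.
- by move=> S; apply: mis_sep; [exact: subsetDl | exact: separatedC].
- move=> S S' /mis_sub subS /mis_sub subS' [E1 E2].
  have D S1 : S1 \subset A -> S1 :&: (A :\: B) = S1 :\: B.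
    by move=> /setIidPl sub; rewrite setIDA sub.
  by rewrite -(setID S B) -(setID S' B) E1 -(D S) // E2 D.
Qed.

End MaximumIndependentSets.

(** * Connected vertex sets *)

Section ConnectedSets.
Variable G : sgraph.
Implicit Types (A B C K M R S U W : {set G}) (u v w x y z : G).

Definition edge_in A : rel G := fun x y => [&& x \in A, y \in A & edge x y].

Definition conn A := [forall x in A, forall y in A, connect (edge_in A) x y].

Definition component A x := [set y in A | connect (edge_in A) x y].

Definition closed_in A B := forall y z, y \in B -> z \in A -> edge y z -> z \in B.

Lemma edge_in_sym A : connect_sym (edge_in A).
Proof.
apply: sym_connect_sym => x y; rewrite /edge_in edge_sym.
by rewrite !andbA (andbC (x \in A)).
Qed.

Lemma closed_in_connect A B x y :
  closed_in A B -> x \in B -> connect (edge_in A) x y -> y \in B.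
Proof.
move=> cl xB /connectP[p pth ->]; elim: p x xB pth => //= z p IH x xB.
by case/andP=> /and3P[_ zA xz]; apply: IH; apply: cl xz.
Qed.

Lemma conn_connect A x y : conn A -> x \in A -> y \in A -> connect (edge_in A) x y.
Proof. by move=> /forall_inP H xA yA; have /forall_inP := H x xA; apply. Qed.

(** A connected set is most easily used, and recognised, through the absence of
    proper nonempty subsets closed under adjacency. *)
Lemma conn_closed A B x : conn A -> x \in A -> x \in B -> closed_in A B -> A \subset B.
Proof.
move=> cA xA xB cl; apply/subsetP => y yA.
exact: closed_in_connect cl xB (conn_connect cA xA yA).
Qed.

Lemma component_closed A x : closed_in A (component A x).
Proof.
move=> y z; rewrite !inE => /andP[yA xy] zA yz; rewrite zA.
by apply: connect_trans xy (connect1 _); rewrite /edge_in yA zA yz.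
Qed.

Lemma component_sub A x : component A x \subset A.
Proof. by apply/subsetP => y; rewrite inE => /andP[]. Qed.

Lemma mem_component A x : x \in A -> x \in component A x.
Proof. by move=> xA; rewrite inE xA connect0. Qed.

Lemma conn_intro A x : x \in A ->
  (forall B, B \subset A -> x \in B -> closed_in A B -> A \subset B) -> conn A.
Proof.
move=> xA H.
have /subsetP sub := H _ (component_sub A x) (mem_component xA) (@component_closed A x).
apply/forall_inP => y /sub; rewrite inE => /andP[_ xy].
apply/forall_inP => z /sub; rewrite inE => /andP[_ xz].
by apply: connect_trans xz; rewrite edge_in_sym.
Qed.

Lemma component_conn A x : x \in A -> conn (component A x).
Proof.
move=> xA; apply: (conn_intro (mem_component xA)) => B sub xB cl.
apply/subsetP => y; rewrite inE => /andP[_]; apply: closed_in_connect xB.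
move=> u v uB vA uv; apply: (cl u) => //.
by apply: component_closed uv; rewrite ?(subsetP sub).
Qed.

Lemma conn_sub_component A B x : conn B -> B \subset A -> x \in B -> B \subset component A x.
Proof.
move=> cB BA xB; apply: (conn_closed cB xB).
  by apply: mem_component; apply: (subsetP BA).
by move=> y z yc zB; apply: component_closed yc _; apply: (subsetP BA).
Qed.

Lemma closed_separated A B : closed_in A B -> separated B (A :\: B).
Proof.
move=> cl; split=> [|x y xB]; first by rewrite disjoint_sym disjoints_subset setDE subsetIr.
rewrite inE => /andP[yB yA]; apply: contra yB; exact: cl.
Qed.

Lemma conn0 : conn set0.
Proof. by apply/forall_inP => x; rewrite inE. Qed.

Lemma conn_add B x y : conn B -> y \in B -> edge x y -> conn (x |: B).
Proof.
move=> cB yB xy; apply: (@conn_intro _ x); first exact: setU11.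
move=> C _ xC cl; rewrite subUset sub1set xC.
apply: (conn_closed cB yB) => [|u v uC vB uv].
  by apply: cl xC _ xy; apply: setU1r.
by apply: cl uC _ uv; apply: setU1r.
Qed.

Lemma not_conn A : ~~ conn A ->
  exists B x y, [/\ B \subset A, x \in B, y \in A :\: B & closed_in A B].
Proof.
rewrite negb_forall_in => /exists_inP[x xA]; rewrite negb_forall_in.
case/exists_inP=> y yA xy; exists (component A x), x, y; split.
- exact: component_sub.
- exact: mem_component.
- by rewrite !inE yA (negPf xy).
- exact: component_closed.
Qed.

Lemma conn_nbr A x y : conn A -> x \in A -> y \in A -> x != y ->
  exists2 z, z \in A & edge x z.
Proof.
move=> cA xA yA xy; have [E|/set0Pn[z]] := eqVneq (nbrs A x) set0; last first.
  by rewrite inE => /andP[zA xz]; exists z.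
have /subsetP/(_ y yA) : A \subset [set x].
  apply: (conn_closed cA xA) => [|u v /set1P-> vA xv]; first exact: set11.
  have : v \in nbrs A x by rewrite inE vA.
  by rewrite E in_set0.
by rewrite inE eq_sym (negPf xy).
Qed.

(** In a connected set every component left by removing [x] is attached to
    [x], for otherwise it would be closed under adjacency. *)
Lemma component_attached A x z : conn A -> x \in A -> z \in A :\ x ->
  exists2 w, w \in component (A :\ x) z & edge x w.
Proof.
move=> cA xA zA; set M := component _ _.
have [/exists_inP[w wM xw]|no] := boolP [exists w in M, edge x w]; first by exists w.
have zM : z \in M by apply: mem_component.
have /subsetP/(_ x xA) : A \subset M.
  apply: (conn_closed cA _ zM) => [|u v uM vA uv]; first by case/setD1P: zA.
  have [vx|vx] := eqVneq v x.
    by case/negP: no; apply/exists_inP; exists u => //; rewrite -vx edge_sym.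
  by apply: component_closed uv => //; rewrite !inE vx.
by move=> /(subsetP (component_sub _ _)); rewrite !inE eqxx.
Qed.

Lemma component_grow A x y z : conn A -> x \in A -> z \in A :\ x ->
  y \in (A :\ x) :\: component (A :\ x) z ->
  x |: component (A :\ x) z \subset component (A :\ y) x.
Proof.
move=> cA xA zA; rewrite inE => /andP[yM /setD1P[yx yA]].
have [w wM xw] := component_attached cA xA zA.
apply: conn_sub_component; rewrite ?setU11 //.
  exact: conn_add (component_conn zA) wM xw.
rewrite subsetD1 in_setU1 (negPf yx) (negPf yM) subUset sub1set xA /= andbT.
exact: subset_trans (component_sub _ _) (subD1set _ _).
Qed.

(** Remove a vertex so that the largest component left is as large as possible:
    that component is everything, since otherwise removing a vertex outside it
    would leave a larger one. *)
Lemma noncut_exists A : conn A -> A != set0 -> exists2 v, v \in A & conn (A :\ v).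
Proof.
move=> cA /set0Pn[x0 x0A].
have [E|/set0Pn[z0 z0A]] := eqVneq (A :\ x0) set0.
  by exists x0 => //; rewrite E conn0.
pose P (p : G * G) := (p.1 \in A) && (p.2 \in A :\ p.1).
have P0 : P (x0, z0) by rewrite /P /= x0A.
case: (arg_maxnP (fun p => #|component (A :\ p.1) p.2|) P0) => -[x z] /andP[/= xA zA] mx.
exists x => //.
have [E|/set0Pn[y yR]] := eqVneq ((A :\ x) :\: component (A :\ x) z) set0.
  suff <- : component (A :\ x) z = A :\ x by apply: component_conn.
  by apply/eqP; rewrite eqEsubset component_sub -setD_eq0 E eqxx.
have yA : y \in A by move: yR; rewrite !inE => /and3P[].
have yx : y != x by move: yR; rewrite !inE => /and3P[].
have /mx /= : P (y, x) by rewrite /P /= yA !inE eq_sym yx xA.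
have := subset_leq_card (component_grow cA xA zA yR).
rewrite cardsU1 [x \in _](_ : _ = false) /= => [lt ge|].
  by have := leq_trans lt ge; rewrite add1n ltnn.
by apply/negP => /(subsetP (component_sub _ _)); rewrite !inE eqxx.
Qed.

(** The same extremal choice among the cut vertices [x] only: then no vertex
    outside [x] and the largest component [M] is a cut vertex. *)
Lemma last_cut_vertex A v : conn A -> v \in A -> ~~ conn (A :\ v) ->
  exists x M, [/\ x \in A, M != set0, conn M, M \subset A :\ x & [/\
    closed_in (A :\ x) M, (A :\ x) :\: M != set0,
    (forall y, y \in (A :\ x) :\: M -> conn (A :\ y)) &
    forall y, y \in (A :\ x) :\: M -> #|component (A :\ x) y| <= #|M|]].
Proof.
move=> cA vA ncv.
have [z0 z0A] : exists z0, z0 \in A :\ v.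
  apply/set0Pn; apply: contra ncv => /eqP->; exact: conn0.
pose P (p : G * G) := [&& p.1 \in A, ~~ conn (A :\ p.1) & p.2 \in A :\ p.1].
have P0 : P (v, z0) by apply/and3P.
case: (arg_maxnP (fun p => #|component (A :\ p.1) p.2|) P0) => -[x z] /and3P[/= xA ncx zA] mx.
exists x, (component (A :\ x) z); split=> //.
- by apply/set0Pn; exists z; apply: mem_component.
- exact: component_conn.
- exact: component_sub.
split=> [||y yR|y yR].
- exact: component_closed.
- apply: contra ncx; rewrite setD_eq0 => sub.
  suff <- : component (A :\ x) z = A :\ x by apply: component_conn.
  by apply/eqP; rewrite eqEsubset component_sub.
- have yA : y \in A by move: yR; rewrite !inE => /and3P[].
  have yx : y != x by move: yR; rewrite !inE => /and3P[].
  apply/negPn/negP => ncy.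
  have /mx /= : P (y, x) by rewrite /P /= yA ncy !inE eq_sym yx xA.
  have := subset_leq_card (component_grow cA xA zA yR).
  rewrite cardsU1 [x \in _](_ : _ = false) /= => [lt ge|].
    by have := leq_trans lt ge; rewrite add1n ltnn.
  by apply/negP => /(subsetP (component_sub _ _)); rewrite !inE eqxx.
- apply: (mx (x, y)); rewrite /P /= xA ncx /=.
  by move: yR; rewrite inE => /andP[].
Qed.

End ConnectedSets.

(** * Counting cycles inside a vertex set *)

Section Cycles.
Variable G : sgraph.
Implicit Types (A B C K M R S U W : {set G}) (u v w x y z : G) (F : {set {set G}}).

Definition cycles_in A := [set F : {set {set G}} | is_cycle F && (cover F \subset A)].

Definition ncyc A := #|cycles_in A|.

Lemma is_cycleP F : reflect
  (exists c : seq G, [/\ 2 < size c, ucycle (@edge G) c & F = cycle_edges c])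
  (is_cycle F).
Proof.
apply: (iffP existsP) => [[k /existsP[c /and3P[k2 uc /eqP->]]]|[c [c2 uc ->]]].
  by exists c; rewrite size_tuple.
have ub : size c < #|G|.+1.
  by rewrite ltnS; have /card_uniqP <- := ucycle_uniq uc; apply: max_card.
by exists (Ordinal ub); apply/existsP; exists (in_tuple c); apply/and3P.
Qed.

Lemma cover_cycle c : cover (cycle_edges c) = [set x : G in c].
Proof.
apply/setP => y; rewrite inE; apply/bigcupP/idP => [[e /imsetP[x xc ->]]|yc].
  by rewrite !inE => /orP[]/eqP->; rewrite ?mem_next.
by exists [set y; next c y]; rewrite ?set21 //; apply/imsetP; exists y.
Qed.

Lemma cycles_inP A F : reflect
  (exists c : seq G, [/\ 2 < size c, ucycle (@edge G) c, {subset c <= A}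
                       & F = cycle_edges c])
  (F \in cycles_in A).
Proof.
rewrite inE; apply: (iffP andP) => [[/is_cycleP[c [c2 uc ->]] sub]|].
  exists c; split=> // x xc; apply: (subsetP sub).
  by rewrite cover_cycle inE.
case=> c [c2 uc sub ->]; split; first by apply/is_cycleP; exists c.
by rewrite cover_cycle; apply/subsetP => x; rewrite inE => /sub.
Qed.

Lemma ncycS A B : A \subset B -> ncyc A <= ncyc B.
Proof.
move=> sub; apply/subset_leq_card/subsetP => F; rewrite !inE => /andP[-> /=].
by move=> /subset_trans; apply.
Qed.

Lemma ncyc_disjoint A B C : A \subset C -> B \subset C -> [disjoint A & B] ->
  ncyc A + ncyc B <= ncyc C.
Proof.
move=> AC BC dis; rewrite /ncyc -cardsUI [X in _ + X](_ : _ = 0) ?addn0.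
  apply/subset_leq_card; rewrite subUset; apply/andP; split.
    by apply/subsetP => F /cycles_inP[c [c2 uc sub E]]; apply/cycles_inP; exists c;
       split=> // x /sub/(subsetP AC).
  by apply/subsetP => F /cycles_inP[c [c2 uc sub E]]; apply/cycles_inP; exists c;
     split=> // x /sub/(subsetP BC).
apply/eqP; rewrite cards_eq0; apply/eqP/setP => F; rewrite in_set0.
apply/negP => /setIP[/cycles_inP[c [c2 _ subA E]]].
rewrite inE => /andP[_]; rewrite E cover_cycle => /subsetP subB.
case: c c2 E subA subB => // x c _ _ /(_ x (mem_head _ _)) xA.
move=> /(_ x); rewrite inE mem_head => /(_ isT) xB.
by have := disjointFr dis xA; rewrite xB.
Qed.

(** A path in [A] between two neighbours of [v] closes up through [v]; the
    edges at [v] remember both ends of the path. *)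
Lemma cycle_through A v w0 w : v \notin A -> w0 \in A -> w \in A -> w0 != w ->
  edge v w0 -> edge v w -> connect (edge_in A) w0 w ->
  exists F, [/\ F \in cycles_in (v |: A), F \notin cycles_in A,
    [set v; w] \in F & forall u, u != v -> [set v; u] \in F -> u \in [set w0; w]].
Proof.
move=> vA w0A wA w0w vw0 vw /connectP[p0 pth0 E0].
case: (shortenP pth0) E0 => p pth up _ Ew {p0 pth0}.
pose c := v :: w0 :: p.
have subA : {subset w0 :: p <= A}.
  move=> x; rewrite inE => /orP[/eqP->//|xp].
  move: pth {up Ew}; elim: p w0 {w0A w0w vw0 c} xp => //= z p IH y.
  rewrite inE => /orP[/eqP->|xp] /andP[/and3P[_ zA _] pth] //.
  exact: IH xp pth.
have subc : {subset c <= v |: A}.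
  by move=> x; rewrite inE => /orP[/eqP->|/subA xA]; rewrite ?setU11 // setU1r.
have uc : uniq c.
  by rewrite cons_uniq up andbT; apply: contra vA; exact: subA.
have p0 : p != [::] by apply: contraNneq w0w => p0; rewrite Ew p0.
have cyc : ucycle (@edge G) c.
  rewrite /ucycle uc andbT /= vw0 rcons_path -Ew edge_sym vw andbT /=.
  by apply: sub_path pth => x y /and3P[].
have c2 : 2 < size c by rewrite /c; case: (p) p0.
have nv : next c v = w0 by rewrite /= eqxx.
have wc : w \in c by rewrite Ew inE mem_last orbT.
have nw : next c w = v.
  by rewrite next_nth wc -[w in index w]/w Ew -[last w0 p]/(last v (w0 :: p))
    index_last //= nth_default.
have vc : v \in c := mem_head _ _.
exists (cycle_edges c); split.
- by apply/cycles_inP; exists c.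
- rewrite inE negb_and cover_cycle; apply/orP; right.
  by apply: contra vA => /subsetP; apply; rewrite inE.
- by apply/imsetP; exists w => //; rewrite nw setUC.
- move=> u uv /imsetP[a ac E]; have : v \in [set a; next c a] by rewrite -E set21.
  have : u \in [set a; next c a] by rewrite -E set22.
  rewrite !inE => ua /orP[/eqP va|/eqP va].
    by move: ua; rewrite -va nv (negPf uv) /= => ->.
  have /(can_inj (prev_next uc)) aw : next c w = next c a by rewrite nw.
  by move: ua; rewrite -va (negPf uv) orbF -aw => ->; rewrite orbT.
Qed.

(** Fixing one neighbour [w0], the cycles through [v], [w0] and each of the
    other neighbours are pairwise distinct, as seen from their edges at [v]. *)
Lemma ncyc_add_vertex A W v : v \notin A -> W \subset A ->
  (forall w, w \in W -> edge v w) ->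
  (forall w w', w \in W -> w' \in W -> connect (edge_in A) w w') ->
  ncyc A + #|W|.-1 <= ncyc (v |: A).
Proof.
move=> vA WA vW con; have [->|/set0Pn[w0 w0W]] := eqVneq W set0.
  by rewrite cards0 addn0 ncycS // subsetUr.
pose P w (F : {set {set G}}) := w \in W :\ w0 ->
  [/\ F \in cycles_in (v |: A), F \notin cycles_in A,
    [set v; w] \in F & forall u, u != v -> [set v; u] \in F -> u \in [set w0; w]].
have /fin_all_exists[f Pf] : forall w, exists F, P w F.
  move=> w; rewrite /P; have [|_] := boolP (w \in W :\ w0); last by exists set0.
  rewrite !inE => /andP[ww0 wW].
  have [||||||F HF] := @cycle_through A v w0 w vA _ _ _ _ _ _; first last.
  - by exists F.
  - exact: con.
  - exact: vW.
  - exact: vW.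
  - by rewrite eq_sym.
  - exact: subsetP wW.
  - exact: subsetP w0W.
have inj : {in W :\ w0 &, injective f}.
  move=> w w' Hw Hw' E; have [_ _ wF _] := Pf w Hw; have [_ _ _ H] := Pf w' Hw'.
  have wv : w != v.
    by apply: contraNneq vA => <-; apply: (subsetP WA); case/setD1P: Hw.
  have := H w wv; rewrite -E wF => /(_ isT); rewrite !inE => /orP[|/eqP//].
  by case/setD1P: Hw => /negPf->.
rewrite (cardsD1 w0 W) w0W add1n /= -(card_in_imset inj) /ncyc.
rewrite -cardsUI [X in _ + X](_ : _ = 0) ?addn0.
  apply: subset_leq_card; rewrite subUset; apply/andP; split.
    apply/subsetP => F; rewrite !inE => /andP[-> /subset_trans->] //.
    exact: subsetUr.
  by apply/subsetP => _ /imsetP[w Hw ->]; have [] := Pf w Hw.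
apply/eqP; rewrite cards_eq0; apply/eqP/setP => F; rewrite in_set0.
apply/negP => /setIP[FA /imsetP[w Hw E]].
by have [_ + _ _] := Pf w Hw; rewrite -E FA.
Qed.

Lemma ncyc_conn_vertex A v : conn (A :\ v) -> v \in A ->
  ncyc (A :\ v) + #|nbrs A v|.-1 <= ncyc A.
Proof.
move=> cA vA; rewrite -[in X in _ <= X](setD1K vA); apply: ncyc_add_vertex.
- by rewrite !inE eqxx.
- apply/subsetP => w; rewrite !inE => /andP[-> vw]; rewrite andbT.
  by apply: contraTneq vw => ->; rewrite edge_irrefl.
- by move=> w; rewrite inE => /andP[].
- move=> w w'; rewrite !inE => /andP[wA vw] /andP[w'A vw'].
  have nv u : edge v u -> u != v by apply: contraTneq => ->; rewrite edge_irrefl.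
  by apply: conn_connect => //; rewrite !inE nv.
Qed.

Lemma ncyc_two_nbrs A v w w' : v \notin A -> w \in A -> w' \in A -> w != w' ->
  edge v w -> edge v w' -> connect (edge_in A) w w' -> ncyc A < ncyc (v |: A).
Proof.
move=> vA wA w'A ww' vw vw' con.
have := @ncyc_add_vertex A [set w; w'] v vA; rewrite cards2 ww' addn1; apply.
- by rewrite subUset !sub1set wA.
- by move=> u /set2P[]->.
- move=> u u' /set2P[]-> /set2P[]->; rewrite ?connect0 //.
  by rewrite edge_in_sym.
Qed.

Lemma next_neq_prev (c : seq G) z : uniq c -> 2 < size c -> z \in c ->
  next c z != prev c z.
Proof.
move=> uniqc c2 zc; apply/eqP => E; have [i c' Ec] := rot_to zc.
have ur : uniq (z :: c') by rewrite -Ec rot_uniq.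
have nE : next (z :: c') z = next c z by rewrite -Ec next_rot.
have pE : prev (z :: c') z = prev c z by rewrite -Ec prev_rot.
have sE : size (z :: c') = size c by rewrite -Ec size_rot.
case: c' Ec ur nE pE sE => [|a [|b c']] Ec ur nE pE sE; try by rewrite -sE in c2.
move: nE; rewrite /= eqxx => nE.
have : next (z :: a :: b :: c') (prev (z :: a :: b :: c') z) = z.
  by apply: next_prev.
rewrite pE -E -nE /= eqxx; case: eqP => [_|_] zz; last first.
  by move: ur; rewrite -zz /= !inE eqxx /= ?orbT.
by move: ur; rewrite /= -zz !inE eqxx.
Qed.

(** A cycle whose vertices have degree at most two contains all the neighbours
    of its vertices, so it would fill the connected set [K], including the
    vertex that has a neighbour outside. *)
Lemma ncyc_path A K x y : conn K -> x \notin K -> x |: K \subset A ->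
  y \in K -> edge x y -> (forall z, z \in K -> #|nbrs A z| <= 2) -> ncyc K = 0.
Proof.
move=> cK xK sub yK xy deg.
apply/eqP; rewrite cards_eq0; apply/eqP/setP => F; rewrite in_set0.
apply/negP => /cycles_inP[c [c2 uc cK' _]].
have KA z : z \in K -> z \in A by move=> zK; apply: (subsetP sub); apply: setU1r.
have nb z : z \in c -> {subset nbrs A z <= c}.
  move=> zc; have np := next_neq_prev (ucycle_uniq uc) c2 zc.
  have : [set next c z; prev c z] \subset nbrs A z.
    case/andP: uc => cyc _.
    rewrite subUset !sub1set !inE !KA ?cK' ?mem_next ?mem_prev //=.
    by rewrite next_cycle // edge_sym prev_cycle.
  move=> subn w; have /eqP <- : [set next c z; prev c z] == nbrs A z.
    by rewrite eqEcard subn cards2 np deg // cK'.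
  by move=> /set2P[]->; rewrite ?mem_next ?mem_prev.
have [z zc] : exists z, z \in c by case: (c) c2 => // z *; exists z; apply: mem_head.
have yc : y \in c.
  have /subsetP/(_ y yK) : K \subset [set u in c].
    apply: (conn_closed cK (cK' z zc)); rewrite ?inE // => u v.
    rewrite !inE => uc' vK uv; apply: (nb u) => //; rewrite inE uv andbT.
    exact: KA.
  by rewrite inE.
have : x \in nbrs A y by rewrite inE edge_sym xy (subsetP sub) // setU11.
by move=> /(nb y yc)/cK'; rewrite (negPf xK).
Qed.

Lemma num_cyclesE : num_cycles G = ncyc [set: G].
Proof. by apply: eq_card => F; rewrite !inE subsetT andbT. Qed.

End Cycles.

Import Order.TTheory GRing.Theory Num.Theory.

(** * The two bounding functions *)

Section Bounds.
Local Open Scope ring_scope.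

(** The count for [b] triangles and otherwise edges, on [n] vertices in all. If
    [n] and [b] have different parities, one cycle is given up. Powers of 3/4
    and 2 keep the exponents natural even if [n < 3 * b], where there
    is no such graph but the recurrences persist. *)
Definition gbound (n b : nat) : rat := (3 / 4) ^+ (b - odd (n + b)) * 2 ^+ (n + b)./2.

(** The share of [gbound] that counts the sets avoiding the centre of the
    extremal graph. *)
Definition lam (q : nat) : rat := if q == 0%N then 1 / 2 else 2 / 3.

(** The number of sets containing that centre: it excludes all the roots, and
    leaves two vertices in each hung triangle. *)
Definition eps (q : nat) : rat := if q == 0%N then 1 else 2 ^+ (q - 1).

Definition hbound (n q : nat) : rat := lam q * gbound n q + eps q.

Lemma gbound_even n b k : (n + b = k.*2)%N -> gbound n b = (3 / 4) ^+ b * 2 ^+ k.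
Proof. by move=> E; rewrite /gbound E odd_double subn0 doubleK. Qed.

Lemma gbound_odd n b k : (n + b = k.*2.+1)%N ->
  gbound n b = (3 / 4) ^+ b.-1 * 2 ^+ k.
Proof. by move=> E; rewrite /gbound E /= odd_double /= uphalf_double subn1. Qed.

Lemma parityP n : {k | n = k.*2} + {k | n = k.*2.+1}.
Proof.
have := odd_double_half n; case: (odd n) => E; last by left; exists n./2.
by right; exists n./2; rewrite -[in LHS]E.
Qed.

Lemma evenP n : ~~ odd n -> exists k, n = k.*2.
Proof. by move=> o; exists n./2; rewrite even_halfK. Qed.

Lemma gbound_gt0 n b : 0 < gbound n b.
Proof.
rewrite /gbound; apply: mulr_gt0; apply: exprn_gt0; last exact: isT.
by lra.
Qed.

Lemma gboundSS n b : gbound n.+2 b = 2 * gbound n b.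
Proof. by rewrite /gbound /= negbK exprS mulrCA. Qed.

Lemma gbound_same n q : ~~ odd (n + q) -> gbound n q.+1 = gbound n q.
Proof.
case/evenP=> k E; rewrite (gbound_even E) (@gbound_odd _ _ k) //; lia.
Qed.

Lemma gbound_pred n q : ~~ odd (n.+1 + q) -> gbound n q = lam q * gbound n.+1 q.
Proof.
case/evenP=> k E; rewrite (gbound_even E) (@gbound_odd _ _ k.-1); last lia.
case: k E => [|k] E; first lia.
case: q E => [|q] E; rewrite /lam /= ?exprS; lra.
Qed.

Lemma gbound_diag n q : ~~ odd (n + q) -> gbound n.+1 q.+1 = 3 / 2 * gbound n q.
Proof.
case/evenP=> k E; rewrite (gbound_even E) (@gbound_even _ _ k.+1); last lia.
rewrite !exprS; lra.
Qed.

Lemma gbound_monoS n b : gbound n b <= gbound n b.+1.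
Proof.
have [[k E]|[k E]] := parityP (n + b)%N.
  by rewrite gbound_same // E odd_double.
rewrite (gbound_odd E) (@gbound_even _ _ k.+1); last lia.
have p m (x : rat) : 0 < x -> 0 < x ^+ m by exact: exprn_gt0.
case: b E => [|b] E; rewrite /= !exprS ?expr0; have := p k 2 isT.
  lra.
by have := p b (3 / 4) isT; nra.
Qed.

Lemma gbound_mono n b b' : (b <= b')%N -> gbound n b <= gbound n b'.
Proof.
move=> /subnK<-; elim: (b' - b)%N => // d IH.
exact: le_trans IH (gbound_monoS _ _).
Qed.

Lemma gbound_monoSn n b : gbound n b <= gbound n.+1 b.
Proof.
have p m (x : rat) : 0 < x -> 0 < x ^+ m by exact: exprn_gt0.
have [[k E]|[k E]] := parityP (n + b)%N.
  rewrite (gbound_even E) (@gbound_odd _ _ k); last lia.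
  case: b E => [|b] E //=; rewrite exprS; have := p k 2 isT.
  by have := p b (3 / 4) isT; nra.
rewrite (gbound_odd E) (@gbound_even _ _ k.+1); last lia.
case: b E => [|b] E; rewrite /= !exprS ?expr0; have := p k 2 isT.
  lra.
by have := p b (3 / 4) isT; nra.
Qed.

Lemma gbound_mono_n n n' b : (n <= n')%N -> gbound n b <= gbound n' b.
Proof.
move=> /subnK<-; elim: (n' - n)%N => // d IH.
exact: le_trans IH (gbound_monoSn _ _).
Qed.

Lemma gboundM n1 b1 n2 b2 :
  gbound n1 b1 * gbound n2 b2 <= gbound (n1 + n2) (b1 + b2).
Proof.
have p m (x : rat) : 0 < x -> 0 < x ^+ m by exact: exprn_gt0.
have e (m : nat) : (3 / 4 : rat) ^+ m <= (3 / 4) ^+ m.-1.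
  by case: m => // m; rewrite exprS /=; have := p m (3 / 4) isT; lra.
have [[k E]|[k E]] := parityP (n1 + b1)%N; have [[l F]|[l F]] := parityP (n2 + b2)%N.
- rewrite (gbound_even E) (gbound_even F) (@gbound_even _ _ (k + l)); last lia.
  rewrite !exprD; lra.
- rewrite (gbound_even E) (gbound_odd F) (@gbound_odd _ _ (k + l)); last lia.
  have -> : (3 / 4 : rat) ^+ b1 * 2 ^+ k * ((3 / 4) ^+ b2.-1 * 2 ^+ l) =
    (3 / 4) ^+ (b1 + b2.-1) * 2 ^+ (k + l) by rewrite !exprD; ring.
  rewrite ler_pM2r ?p //; case: b2 {F} => [|b2]; first by rewrite !addn0.
  by rewrite addnS.
- rewrite (gbound_odd E) (gbound_even F) (@gbound_odd _ _ (k + l)); last lia.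
  have -> : (3 / 4 : rat) ^+ b1.-1 * 2 ^+ k * ((3 / 4) ^+ b2 * 2 ^+ l) =
    (3 / 4) ^+ (b1.-1 + b2) * 2 ^+ (k + l) by rewrite !exprD; ring.
  rewrite ler_pM2r ?p //; case: b1 {E} => [|b1]; first by rewrite !add0n.
  by rewrite addSn.
- rewrite (gbound_odd E) (gbound_odd F) (@gbound_even _ _ (k + l).+1); last lia.
  have -> : (3 / 4 : rat) ^+ b1.-1 * 2 ^+ k * ((3 / 4) ^+ b2.-1 * 2 ^+ l) =
    (3 / 4) ^+ (b1.-1 + b2.-1) * 2 ^+ (k + l) by rewrite !exprD; ring.
  rewrite [_ ^+ _.+1]exprS mulrA ler_pM2r ?p //.
  case: b1 {E} => [|b1]; case: b2 {F} => [|b2];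
    rewrite /= ?add0n ?addn0 ?addnS ?addSn ?exprS; first by lra.
  + by have := p b2 (3 / 4) isT; lra.
  + by have := p b1 (3 / 4) isT; lra.
  + by have := p (b1 + b2)%N (3 / 4) isT; lra.
Qed.

Lemma lam_ge q : 1 / 2 <= lam q.
Proof. by rewrite /lam; case: eqP => _; lra. Qed.

Lemma eps_gt0 q : 0 < eps q.
Proof. by rewrite /eps; case: eqP => // _; rewrite exprn_gt0. Qed.

End Bounds.

(** * The bound for arbitrary graphs *)

Section GeneralBound.
Local Open Scope ring_scope.

Lemma gbound_diag_ge n b : 3 / 2 * gbound n b <= gbound n.+1 b.+1.
Proof.
have [o|o] := boolP (odd (n + b)); last by rewrite -(gbound_diag o) lexx.
case: b o => [|b] o.
  rewrite gbound_same; last by lia.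
  rewrite (@gbound_pred n); last by lia.
  by have := gbound_gt0 n.+1 0; rewrite /lam /=; lra.
rewrite gbound_same; last by lia.
rewrite gbound_same; last by lia.
by rewrite -gbound_diag //; lia.
Qed.

Variable G : sgraph.
Implicit Types (A B C K M R S U W : {set G}) (u v w x y z : G).

Lemma mis_without_leaf A v w S : nbrs A v = [set w] -> v \in A -> S \in mis A ->
  v \notin S -> w \in S.
Proof.
move=> nv vA HS vS; apply/negPn/negP => wS; have [I sub mx] := misP _ _ HS.
have := mx (v |: S); rewrite cardsU1 vS add1n ltnn.
rewrite subUset sub1set vA sub => H; suff: false by []; apply: H => //.
apply: independentU1 I _ => y yS; apply: contra wS => vy.
have : y \in nbrs A v by rewrite inE vy (subsetP sub).
by rewrite nv inE => /eqP<-.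
Qed.

(** A maximum independent set that misses the leaf [v] contains its neighbour
    [w], so swapping the two compares both kinds with the sets of the rest. *)
Lemma mu_leaf A v w : nbrs A v = [set w] -> v \in A ->
  (mu A <= 2 * mu (A :\: [set v; w]))%N.
Proof.
move=> nv vA; rewrite (mu_split A v) mul2n -addnn leq_add //; last first.
  by have := mu_with A v; rewrite nv.
have HwS S : S \in [set S in mis A | v \notin S] -> w \in S.
  by rewrite inE => /andP[HS vS]; apply: mis_without_leaf HS vS.
rewrite -(card_in_imset (f := fun S => S :\ w)); last first.
  by move=> S S' /HwS wS /HwS wS' E; rewrite -(setD1K wS) -(setD1K wS') E.
apply/subset_leq_card/subsetP => _ /imsetP[S HS ->]; have wS := HwS S HS.
move: HS; rewrite inE => /andP[/misP[I sub mx] vS]; apply/misP; split.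
- exact: independentS (subD1set _ _) I.
- apply/subsetP => y; rewrite !inE => /andP[yw yS]; rewrite negb_or yw !andbT.
  by rewrite (subsetP sub) // andbT; apply: contraNneq vS => <-.
- move=> S' I' sub'; have vS' : v \notin S'.
    by apply/negP => /(subsetP sub'); rewrite !inE eqxx.
  rewrite -ltnS (cardsD1 w S) wS in mx *.
  have := mx (v |: S'); rewrite cardsU1 vS' !add1n; apply.
    apply: independentU1 I' _ => y /(subsetP sub'); rewrite !inE negb_or.
    case/andP=> /andP[_ yw] yA; apply: contra yw => vy.
    have : y \in nbrs A v by rewrite inE vy yA.
    by rewrite nv inE.
  by rewrite subUset sub1set vA (subset_trans sub' (subsetDl _ _)).
Qed.

Lemma card_nbrsD A v : v \in A -> #|A :\: (v |: nbrs A v)| = (#|A| - #|nbrs A v|.+1)%N.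
Proof.
move=> vA; rewrite cardsD (setIidPr _); last first.
  by rewrite subUset sub1set vA; apply/subsetP => y; rewrite inE => /andP[].
by rewrite cardsU1 inE vA edge_irrefl.
Qed.

Lemma nbrs_lt A v : v \in A -> (#|nbrs A v| < #|A|)%N.
Proof.
move=> vA; rewrite (cardsD1 v A) vA add1n ltnS; apply/subset_leq_card/subsetP => y.
by rewrite !inE => /andP[-> vy]; rewrite andbT; apply: contraTneq vy => ->;
  rewrite edge_irrefl.
Qed.

Lemma setDU1_sub A v : A :\: (v |: nbrs A v) \subset A :\ v.
Proof. by apply: setDS; rewrite sub1set setU11. Qed.

(** Components multiply; a leaf costs a factor two and two vertices; removing
    a vertex of degree at least two that does not disconnect destroys a cycle,
    which pays for the second branch. *)
Theorem mu_le_gbound A : (mu A)%:R <= gbound #|A| (ncyc A).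
Proof.
have [n] := ubnP #|A|; elim: n A => // n IH A /ltnSE leA.
have [->|A0] := eqVneq A set0.
  rewrite mu0 cards0 /gbound add0n.
  apply: (le_trans _ (gbound_mono 0 (leq0n _))).
  by rewrite /gbound.
have [cA|/not_conn[B [x [y [BA xB yAB cl]]]]] := boolP (conn A); last first.
  have sep := closed_separated cl.
  have Bn : (#|B| < n)%N.
    apply: leq_trans leA; apply/proper_card/properP; split=> //.
    by exists y; move: yAB; rewrite inE => /andP[].
  have Cn : (#|A :\: B| < n)%N.
    apply: leq_trans leA; apply/proper_card/properP; split; first exact: subsetDl.
    by exists x; rewrite ?inE ?xB // (subsetP BA).
  apply: (@le_trans _ _ (mu B * mu (A :\: B))%:R).
    by rewrite ler_nat mu_sep.
  rewrite natrM; apply: (@le_trans _ _ (gbound #|B| (ncyc B) *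
      gbound #|A :\: B| (ncyc (A :\: B)))).
    by rewrite ler_pM // IH.
  apply: le_trans (gboundM _ _ _ _) _.
  have -> : (#|B| + #|A :\: B|)%N = #|A|.
    by rewrite -(cardsID B A) (setIidPr BA).
  by apply: gbound_mono; apply: ncyc_disjoint (BA) (subsetDl _ _) sep.1.
have [v vA cv] := noncut_exists cA A0.
have := ncyc_conn_vertex cv vA.
have cA1 : #|A :\ v| = #|A|.-1 by rewrite (cardsD1 v A) vA.
have ltA := nbrs_lt vA; have cAN := card_nbrsD vA.
have muv := mu_vertex A v.
case E : #|nbrs A v| => [|[|d]].
- (* without neighbours, the connected set is a single vertex *)
  move=> _; have A1 : A = [set v].
    apply/eqP; rewrite eqEsubset sub1set vA andbT.
    apply: (conn_closed cA vA); rewrite ?set11 // => u z /set1P-> zA vz.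
    move/eqP: E; rewrite cards_eq0 => /eqP/setP/(_ z).
    by rewrite !inE zA vz.
  rewrite A1 mu1 cards1; apply: le_trans (gbound_mono 1 (leq0n _)).
  by rewrite /gbound.
- move=> _; move/eqP/cards1P: E => [w nw].
  have wA : w \in A :\ v.
    have : w \in nbrs A v by rewrite nw set11.
    rewrite !inE => /andP[-> vw]; rewrite andbT; apply: contraTneq vw => ->.
    by rewrite edge_irrefl.
  have cA2 : #|A| = #|A :\: [set v; w]|.+2.
    by rewrite (cardsD1 v A) vA (cardsD1 w (A :\ v)) wA setDDl.
  apply: (@le_trans _ _ (2 * mu (A :\: [set v; w]))%:R).
    by rewrite ler_nat mu_leaf.
  rewrite natrM cA2 gboundSS ler_pM2l //.
  apply: le_trans (IH _ _) _; first by lia.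
  by apply: gbound_mono; apply: ncycS; apply: subsetDl.
- rewrite /= => leC.
  have [b Eb] : exists b, ncyc A = b.+1 by exists (ncyc A).-1; lia.
  have [m Em] : exists m, #|A| = m.+3 by exists (#|A| - 3)%N; lia.
  have b1 : (mu (A :\ v))%:R <= gbound m.+2 b.
    apply: le_trans (IH _ _) _; first by rewrite cA1; lia.
    by rewrite cA1 Em /=; apply: gbound_mono; lia.
  have b2 : (mu (A :\: (v |: nbrs A v)))%:R <= gbound m b.
    apply: le_trans (IH _ _) _; first by rewrite cAN; lia.
    apply: (@le_trans _ _ (gbound m (ncyc (A :\: (v |: nbrs A v))))).
      by apply: gbound_mono_n; lia.
    apply: gbound_mono; have := ncycS (setDU1_sub A v); lia.
  apply: (@le_trans _ _ (mu (A :\ v) + mu (A :\: (v |: nbrs A v)))%:R).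
    by rewrite ler_nat.
  have := gbound_diag_ge m b; rewrite natrD Em Eb !gboundSS in b1 b2 *; lra.
Qed.

Lemma mu_le n b A : (#|A| <= n)%N -> (ncyc A <= b)%N -> (mu A)%:R <= gbound n b.
Proof.
move=> leA leb; apply: le_trans (mu_le_gbound A) _.
exact: le_trans (gbound_mono_n _ leA) (gbound_mono _ leb).
Qed.

End GeneralBound.

(** * Pendant pieces at a cut vertex *)

Section Pendants.
Variable G : sgraph.
Implicit Types (A B C K M R S U W : {set G}) (u v w x y z : G).

Lemma nbrsS A B v : A \subset B -> nbrs A v \subset nbrs B v.
Proof. by move=> /subsetP sub; apply/subsetP => y; rewrite !inE => /andP[/sub->]. Qed.

Lemma nbrsD1 A v y : nbrs (A :\ y) v = nbrs A v :\ y.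
Proof. by apply/setP => z; rewrite !inE andbA. Qed.

(** In a path whose end [y] and whose other end are not in [S], sliding every
    vertex of [S] one step away from [y] makes room for [y]. *)
Lemma shift_independent K S y :
  (forall z, z \in K -> #|nbrs K z| <= 2) -> y \in K -> #|nbrs K y| <= 1 ->
  y \notin S -> S \subset K -> independent S ->
  (forall s, s \in S -> #|nbrs K s| = 2) ->
  exists S' : {set G}, [/\ independent S', S' \subset K & #|S'| = #|S|.+1].
Proof.
have [n] := ubnP #|S|; elim: n K S y => // n IH K S y /ltnSE leS.
move=> deg yK degy yS SK I degS.
have [/exists_inP[s sS ys]|no] := boolP [exists s in S, edge y s]; last first.
  exists (y |: S); split.
  - apply: independentU1 I _ => s sS; apply: contra no => ys.
    by apply/exists_inP; exists s.
  - by rewrite subUset sub1set yK.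
  - by rewrite cardsU1 yS.
have sK := subsetP SK s sS.
have ny : nbrs K y = [set s].
  apply/eqP; rewrite eq_sym eqEcard sub1set inE sK ys cards1 /=.
  exact: degy.
have [t tN ty] : exists2 t, t \in nbrs K s & t != y.
  have : 0 < #|nbrs K s :\ y|.
    have := cardsD1 y (nbrs K s); rewrite inE yK edge_sym ys degS //; lia.
  by move=> /card_gt0P[t]; rewrite in_setD1 => /andP[ty tN]; exists t.
move: (tN); rewrite inE => /andP[tK st].
have ts : t != s by apply: contraTneq st => ->; rewrite edge_irrefl.
pose K' := K :\ y :\ s.
have K'K : K' \subset K by rewrite /K' setDDl subsetDl.
have tK' : t \in K' by rewrite !inE ts ty.
have [S' [I' sub' card']] : exists S' : {set G},
    [/\ independent S', S' \subset K' & #|S'| = #|S :\ s|.+1].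
  apply: (IH _ _ t) => //.
  - by move: leS; rewrite (cardsD1 s S) sS.
  - by move=> z /(subsetP K'K) zK; apply: leq_trans (deg z zK);
      apply/subset_leq_card/nbrsS.
  - rewrite -ltnS; apply: leq_trans (deg t tK).
    rewrite (cardsD1 s (nbrs K t)) inE sK edge_sym st add1n ltnS.
    by apply: subset_leq_card; rewrite /K' nbrsD1 nbrsD1 setSD // subD1set.
  - rewrite !inE negb_and; apply/orP; right.
    by apply: contraL st; apply: (independentP _ I).
  - apply/subsetP => z; rewrite !inE => /andP[-> zS]; rewrite (subsetP SK) //.
    by rewrite andbT; apply: contraNneq yS => <-.
  - exact: independentS (subD1set _ _) I.
  - move=> z; rewrite !inE => /andP[zs zS]; rewrite -(degS z zS).
    apply/eq_card => w; rewrite !inE.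
    have [->|wy] := eqVneq w y.
      rewrite andbF /=; symmetry; apply/negbTE.
      apply: contra zs => /andP[_ zy]; have : z \in nbrs K y.
        by rewrite inE edge_sym zy (subsetP SK).
      by rewrite ny inE.
    have [->|//] := eqVneq w s.
    by rewrite (negPf (independentP _ I _ _ zS sS)) !andbF.
have yS' : y \notin S' by apply/negP => /(subsetP sub'); rewrite !inE eqxx andbF.
exists (y |: S'); split.
- apply: independentU1 I' _ => z /(subsetP sub'); rewrite !inE.
  case/and3P=> zs _ zK; apply: contra zs => yz.
  have : z \in nbrs K y by rewrite inE zK.
  by rewrite ny inE.
- by rewrite subUset sub1set yK (subset_trans sub' K'K).
- by rewrite cardsU1 yS' card' (cardsD1 s S) sS.
Qed.

(** The piece [K] is a leaf at [x], or a path whose ends are adjacent to [x];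
    [pendant_deg] and [pendant_leaf_or_cycle] derive this from the absence of
    cut vertices in [K]. *)
Definition pendant A x K := [/\ x \in A, K \subset A :\ x, conn K,
  closed_in (A :\ x) K & [/\ nbrs K x != set0, conn A &
  forall z, z \in K -> conn (A :\ z) /\ #|nbrs A z| <= 2]].

Lemma pendant_nbrs A x K z : pendant A x K -> z \in K ->
  nbrs A z \subset x |: nbrs K z.
Proof.
case=> xA KA cK cl [nx cA deg] zK; apply/subsetP => y; rewrite !inE => /andP[yA zy].
have [//|yx] := eqVneq y x; rewrite zy andbT.
by apply: cl zK _ zy; rewrite !inE yx.
Qed.

(** A vertex of degree one inside the piece would hang off a cut vertex. *)
Lemma pendant_deg A x K z : pendant A x K -> z \in K -> ~~ edge x z ->
  #|nbrs K z| = 2.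
Proof.
move=> pd zK xz; have [xA KA cK cl [nx cA deg]] := pd.
have /setD1P[zx zA] := subsetP KA z zK.
have nE : nbrs A z = nbrs K z.
  apply/eqP; rewrite eqEsubset (nbrsS z (subset_trans KA (subD1set _ _))) andbT.
  apply/subsetP => y yN; move: (yN).
  move=> /(subsetP (pendant_nbrs pd zK)) /setU1P[yx|//].
  by move: yN; rewrite yx inE edge_sym (negPf xz) andbF.
have [_ le2] := deg z zK; rewrite -nE.
apply/eqP; rewrite eqn_leq le2 /= ltnNge; apply/negP => le1.
have [w wA zw] := conn_nbr cA zA xA zx.
have nw : nbrs A z = [set w].
  by apply/eqP; rewrite eq_sym eqEcard sub1set inE wA zw cards1.
have wK : w \in K.
  have : w \in nbrs K z by rewrite -nE nw set11.
  by rewrite inE => /andP[].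
have [cw _] := deg w wK.
have zw' : z != w by apply: contraTneq zw => ->; rewrite edge_irrefl.
have zAw : z \in A :\ w by rewrite !inE zw'.
have xw : x != w by apply: contraTneq wK => <-; apply/negP => /(subsetP KA); rewrite !inE eqxx.
have xAw : x \in A :\ w by rewrite !inE xw.
have [u] := conn_nbr cw zAw xAw zx; rewrite !inE => /andP[uw uA] zu.
have : u \in nbrs A z by rewrite inE uA.
by rewrite nw inE (negPf uw).
Qed.

(** If [y] were the only neighbour of [x] in [K], it would separate the rest of
    [K] from [x]. *)
Lemma pendant_leaf_or_cycle A x K : pendant A x K -> #|K| = 1 \/ 1 < #|nbrs K x|.
Proof.
move=> pd; have [xA KA cK cl [nx cA deg]] := pd.
have [?|le1] := ltnP 1 #|nbrs K x|; [by right | left].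
case/set0Pn: nx => y yN; have nxE : nbrs K x = [set y].
  by apply/eqP; rewrite eq_sym eqEcard sub1set yN cards1.
move: yN; rewrite inE => /andP[yK xy].
suff -> : K = [set y] by rewrite cards1.
apply/eqP; rewrite eqEsubset sub1set yK andbT -setD_eq0.
apply/negPn/negP => /set0Pn[z]; rewrite !inE => /andP[zy zK].
have [cy _] := deg y yK.
have zA : z \in A by have /setD1P[] := subsetP KA z zK.
have xNK : x \notin K by apply/negP => /(subsetP KA); rewrite !inE eqxx.
have : x \in K :\ y.
  have yx : x != y by apply: contraNneq xNK => ->.
  apply: (subsetP (conn_closed (x := z) (B := K :\ y) cy _ _ _) x); rewrite ?inE ?zy ?yx //.
  move=> u v; rewrite !inE => /andP[uy uK] /andP[vy vA] uv; rewrite vy.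
  apply: cl (uK) _ (uv); rewrite !inE vA andbT; apply: contra uy => /eqP vx.
  have : u \in nbrs K x by rewrite inE uK edge_sym -vx.
  by rewrite nxE inE.
by rewrite inE (negPf xNK) andbF.
Qed.

Lemma pendant_shift A x K S : pendant A x K -> S \subset K -> independent S ->
  (forall s, s \in S -> ~~ edge x s) ->
  exists S' : {set G}, [/\ independent S', S' \subset K & #|S'| = #|S|.+1].
Proof.
move=> pd SK I nS; have [xA KA cK cl [nx cA deg]] := pd.
have KA' : K \subset A := subset_trans KA (subD1set _ _).
case/set0Pn: nx => y; rewrite inE => /andP[yK xy].
have xNK : x \notin K by apply/negP => /(subsetP KA); rewrite !inE eqxx.
apply: (@shift_independent K S y) => //.
- move=> z zK; apply: leq_trans (deg z zK).2; exact/subset_leq_card/nbrsS.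
- rewrite -ltnS; apply: leq_trans (deg y yK).2.
  apply/proper_card/properP; split; first exact: nbrsS.
  by exists x; rewrite inE ?xA 1?edge_sym // (negPf xNK).
- by apply/negP => /nS; rewrite xy.
- by move=> s sS; apply: (pendant_deg pd); rewrite ?(subsetP SK) ?nS.
Qed.

Lemma pendant_ncyc0 A x K : pendant A x K -> ncyc K = 0.
Proof.
move=> pd; have [xA KA cK cl [nx cA deg]] := pd.
case/set0Pn: nx => y; rewrite inE => /andP[yK xy].
apply: (@ncyc_path _ A K x y) => //.
- by apply/negP => /(subsetP KA); rewrite !inE eqxx.
- by rewrite subUset sub1set xA (subset_trans KA) // subD1set.
- by move=> z /deg[].
Qed.

Lemma pendant_separated A x K : pendant A x K -> separated K ((A :\ x) :\: K).
Proof. by case=> _ _ _ cl _; apply: closed_separated. Qed.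

Lemma pendant_card A x K S : pendant A x K -> x \in S -> S \subset A ->
  #|S| = (#|S :&: K| + #|S :&: ((A :\ x) :\: K)|).+1.
Proof.
case=> xA KA _ _ _ xS SA; rewrite (cardsD1 x S) xS add1n; congr _.+1.
rewrite -(cardsID K (S :\ x)); congr (_ + _); apply: eq_card => z; rewrite !inE.
  have [->|//] := eqVneq z x; rewrite /= andbC; case: (boolP (x \in K)) => //.
  by move/(subsetP KA); rewrite !inE eqxx.
by have [zS|] := boolP (z \in S); rewrite ?andbF //= (subsetP SA _ zS) !andbT andbC.
Qed.

(** Through the shift, a maximum independent set that contains [x] may give up
    [x] and recover the loss inside the pendant piece; so it has to be maximum
    on the remaining part [M] already. *)
Lemma mis_with_pendant A x K S : pendant A x K -> S \in mis A -> x \in S ->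
  S :&: ((A :\ x) :\: K) \in mis ((A :\ x) :\: K).
Proof.
move=> pd HS xS; have [I SA mx] := misP _ _ HS.
have [xA KA cK cl _] := pd; have [_ sep] := pendant_separated pd.
have nS s : s \in S :&: K -> ~~ edge x s.
  by rewrite inE => /andP[sS _]; apply: (independentP _ I).
have [T [IT TK cT]] :=
  pendant_shift pd (subsetIr S K) (independentS (subsetIl _ _) I) nS.
apply/misP; split; [exact: independentS (subsetIl _ _) I | exact: subsetIr |].
move=> S' I' sub'; have := mx (T :|: S').
rewrite cardsU (disjoint_setI0 _) ?cards0 ?subn0; last first.
  apply: disjointWl TK _; apply: disjointWr sub' _.
  by rewrite disjoint_sym disjoints_subset setDE subsetIr.
rewrite cT (pendant_card pd xS SA) addSn ltnS leq_add2l; apply.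
  apply: independentU IT I' _ => a b aT bS.
  by apply: sep; [apply: (subsetP TK) | apply: (subsetP sub')].
have AxA : A :\ x \subset A := subD1set _ _.
rewrite subUset (subset_trans TK) ?(subset_trans KA) //=.
exact: subset_trans sub' (subset_trans (subsetDl _ _) AxA).
Qed.

Lemma mis_with_pendant_inside A x K S : pendant A x K -> S \in mis A -> x \in S ->
  S :&: K \in mis (K :\: nbrs A x).
Proof.
move=> pd HS xS; have [I SA mx] := misP _ _ HS.
have [xA KA cK cl _] := pd; have [dis sep] := pendant_separated pd.
have nS s : s \in S -> ~~ edge x s by apply: (independentP _ I).
apply/misP; split.
- exact: independentS (subsetIl _ _) I.
- apply/subsetP => s; rewrite !inE => /andP[sS ->].
  by rewrite (negPf (nS s sS)) andbF.
- move=> S' I' sub'; set M := _ :\: K in dis sep.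
  have S'K : S' \subset K := subset_trans sub' (subsetDl _ _).
  have xS' : x \notin S' :|: (S :&: M).
    rewrite !inE eqxx !andbF orbF; apply/negP => /(subsetP S'K)/(subsetP KA).
    by rewrite !inE eqxx.
  have := mx (x |: (S' :|: (S :&: M))); rewrite cardsU1 xS'.
  have dis' : [disjoint S' & S :&: M].
    by apply: disjointWl S'K _; apply: disjointWr dis; apply: subsetIr.
  rewrite cardsU (disjoint_setI0 dis') cards0 subn0 (pendant_card pd xS SA) add1n ltnS leq_add2r; apply.
    apply: independentU1 => [|y].
      apply: independentU I' (independentS (subsetIl _ _) I) _ => a b aS.
      by rewrite inE => /andP[_]; apply: sep; apply: (subsetP S'K).
    rewrite in_setU => /orP[yS|/setIP[/nS//]].
    have := subsetP sub' y yS; rewrite !inE negb_and => /andP[/orP[|//] + yK].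
    by have /setD1P[_ ->] := subsetP KA y yK.
  have AxA : A :\ x \subset A := subD1set _ _.
  rewrite !subUset sub1set xA (subset_trans S'K) ?(subset_trans KA) //=.
  exact: subset_trans (subsetIl _ _) SA.
Qed.

Lemma mu_pendant A x K : pendant A x K -> mu A <= mu K * mu ((A :\ x) :\: K) +
  mu (K :\: nbrs A x) * avoiding ((A :\ x) :\: K) (nbrs A x).
Proof.
move=> pd; rewrite (mu_split A x); set M := _ :\: K.
have [xA KA cK cl _] := pd.
have split_eq S1 S2 : S1 \subset A -> S2 \subset A -> (x \in S1) = (x \in S2) ->
    S1 :&: K = S2 :&: K -> S1 :&: M = S2 :&: M -> S1 = S2.
  move=> /subsetP s1 /subsetP s2 Ex EK EM; apply/setP => z.
  have [->//|zx] := eqVneq z x.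
  have [zK|zK] := boolP (z \in K).
    by have := congr1 (fun X : {set G} => z \in X) EK; rewrite !inE zK !andbT.
  have [zA|zA] := boolP (z \in A).
    by have := congr1 (fun X : {set G} => z \in X) EM; rewrite !inE zK zx zA !andbT.
  by apply/idP/idP => [/s1|/s2]; rewrite (negPf zA).
apply: leq_add.
  apply: leq_trans (mu_sep KA (pendant_separated pd)).
  apply/subset_leq_card/subsetP => S; rewrite inE => /andP[HS xS].
  exact: mis_without.
apply: (card_leq_prod (f1 := fun S => S :&: K) (f2 := fun S => S :&: M)).
- by move=> S; rewrite inE => /andP[HS xS]; apply: mis_with_pendant_inside.
- move=> S; rewrite inE => /andP[HS xS]; rewrite inE mis_with_pendant //=.
  rewrite disjoint_subset; apply/subsetP => s; rewrite !inE => /andP[sS _].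
  by rewrite (negPf (independentP _ (mis_ind HS) _ _ xS sS)) andbF.
- move=> S1 S2; rewrite !inE => /andP[H1 x1] /andP[H2 x2] [EK EM].
  by apply: split_eq EK EM; rewrite ?(mis_sub H1) ?(mis_sub H2) // x1.
Qed.

(** With two pendant pieces, giving up [x] gains one vertex in each. *)
Lemma two_pendants A x K K' S : pendant A x K -> pendant A x K' ->
  [disjoint K & K'] -> S \in mis A -> x \notin S.
Proof.
move=> pd pd' dis HS; apply/negP => xS.
have HM := mis_with_pendant pd HS xS; set M := _ :\: K in HM.
have [xA KA' cK' cl' _] := pd'; have I := mis_ind HS.
have K'M : K' \subset M by rewrite subsetD KA' disjoint_sym.
have clM : closed_in M K'.
  by move=> u v uK' vM; apply: cl' => //; apply: subsetP vM; apply: subsetDl.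
have /misP[_ _ mx] := mis_sep K'M (closed_separated clM) HM.
have [|T [IT TK cT]] := pendant_shift pd' (subsetIr S K') (independentS (subsetIl _ _) I).
  by move=> s; rewrite inE => /andP[sS _]; apply: (independentP _ I).
have := mx T IT TK; rewrite cT -setIA (setIidPr K'M) ltnn; exact: id.
Qed.

End Pendants.

Section Structure.
Variable G : sgraph.
Implicit Types (A B C K M R S U W : {set G}) (u v w x y z : G).

Lemma leaf_nbr_cut A v w z : conn A -> nbrs A v = [set w] -> v \in A -> z \in A ->
  z != v -> z != w -> ~~ conn (A :\ w).
Proof.
move=> cA nv vA zA zv zw; apply/negP => cw.
have vw : v != w.
  by have := set11 w; rewrite -nv inE => /andP[_]; apply: contraTneq => ->; rewrite edge_irrefl.
have [|||u /setD1P[uw uA] vu] := @conn_nbr _ _ v z cw.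
- by rewrite !inE vw.
- by rewrite !inE zw.
- by rewrite eq_sym.
have : u \in nbrs A v by rewrite inE uA.
by rewrite nv inE (negPf uw).
Qed.

Lemma pendant_cycle A x K : pendant A x K -> 1 < #|nbrs K x| -> ncyc (A :\ x) < ncyc A.
Proof.
case=> xA KA cK _ _ /card_gt1P[w [w' []]]; rewrite !inE.
move=> /andP[wK xw] /andP[w'K xw'] ww'.
rewrite -[in X in _ < X](setD1K xA); apply: (ncyc_two_nbrs (w := w) (w' := w')) => //.
- by rewrite !inE eqxx.
- exact: subsetP wK.
- exact: subsetP w'K.
apply: connect_sub (conn_connect cK wK w'K) => a b /and3P[aK bK ab].
by apply: connect1; rewrite /edge_in ab !(subsetP KA).
Qed.

Lemma pendant_rest_attached A x K z : pendant A x K -> z \in (A :\ x) :\: K ->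
  exists2 w, w \in (A :\ x) :\: K & edge x w.
Proof.
move=> pd; have [xA KA cK cl [_ cA _]] := pd; rewrite inE => /andP[zK zA].
have [w wc xw] := component_attached cA xA zA; exists w => //.
rewrite inE (subsetP (component_sub _ _) _ wc) andbT; apply: contra zK => wK.
move: wc; rewrite inE edge_in_sym => /andP[_ wz].
exact: closed_in_connect cl wK wz.
Qed.

Lemma pendant_disjoint A x K y : pendant A x K -> y \in (A :\ x) :\: K ->
  [disjoint K & component (A :\ x) y].
Proof.
move=> [xA KA cK cl _]; rewrite inE => /andP[yK yA].
rewrite disjoint_subset; apply/subsetP => z zK; apply/negP => /=.
rewrite inE edge_in_sym => /andP[_ zy]; case/negP: yK.
exact: closed_in_connect cl zK zy.
Qed.

(** The components other than the largest one contain no cut vertex, hence they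
    are pendant pieces; if there are two of them, [two_pendants] applies. *)
Lemma pendant_structure A v : conn A -> v \in A -> ~~ conn (A :\ v) ->
  (forall y, y \in A -> conn (A :\ y) -> #|nbrs A y| <= 2) ->
  exists x K, pendant A x K /\
    ([/\ conn ((A :\ x) :\: K), (A :\ x) :\: K != set0
       & #|K| <= #|(A :\ x) :\: K|] \/
     forall S, S \in mis A -> x \notin S).
Proof.
move=> cA vA ncv deg.
have [x [M [xA M0 cM MA [clM R0 ncR mxR]]]] := last_cut_vertex cA vA ncv.
have [m mM] := set0Pn _ M0.
have pd y : y \in (A :\ x) :\: M -> pendant A x (component (A :\ x) y).
  move=> yR; have yA : y \in A :\ x by move: yR; rewrite inE => /andP[].
  split=> //; [exact: component_sub | exact: component_conn | exact: component_closed |].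
  split=> //.
    have [w wc xw] := component_attached cA xA yA.
    by apply/set0Pn; exists w; rewrite inE wc.
  move=> z zc; have zR : z \in (A :\ x) :\: M.
    rewrite inE (subsetP (component_sub _ _) _ zc) andbT.
    move: yR; rewrite inE => /andP[yM _]; apply: contra yM => zM.
    apply: closed_in_connect clM zM _.
    by move: zc; rewrite inE edge_in_sym => /andP[].
  have cz := ncR z zR; split=> //; apply: deg => //.
  by move: zR; rewrite !inE => /and3P[].
have [y yR] := set0Pn _ R0; have pdy := pd y yR.
set K := component _ y in pdy; exists x, K; split=> //.
have [RK|] := boolP (((A :\ x) :\: M) \subset K).
  left; have <- : M = (A :\ x) :\: K.
    apply/setP => z; rewrite inE.
    have [zA|zA] := boolP (z \in A :\ x); last first.
      by rewrite andbF; apply/negbTE; apply: contra zA; apply: (subsetP MA).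
    rewrite andbT; have [zM|zM] := boolP (z \in M).
      symmetry; apply/negP => zK; move: yR; rewrite inE => /andP[yM _].
      case/negP: yM; apply: closed_in_connect clM zM _.
      by move: zK; rewrite inE edge_in_sym => /andP[].
    by symmetry; apply/negbTE; rewrite negbK (subsetP RK) // inE zM.
  by split=> //; apply: mxR.
case/subsetPn=> y' yR' yK'; right=> S HS.
apply: (two_pendants pdy (pd y' yR')) HS; apply: pendant_disjoint pdy _.
by move: yR'; rewrite !in_setD => /andP[_ ->]; rewrite yK'.
Qed.

(** If the degree of every vertex that does not cut is at most two and there
    is no cut vertex, the graph is a cycle, seen here as [x] with one pendant
    piece made of everything else. *)
Lemma uncut_structure A x : conn A -> 2 < #|A| -> x \in A ->
  (forall y, y \in A -> conn (A :\ y)) ->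
  (forall y, y \in A -> #|nbrs A y| <= 2) ->
  pendant A x (A :\ x) /\ 1 < #|nbrs (A :\ x) x|.
Proof.
move=> cA A3 xA nc deg.
have cA1 : #|A :\ x| = #|A|.-1 by rewrite (cardsD1 x A) xA.
have pd : pendant A x (A :\ x).
  split=> //; [exact: nc | split=> //].
    have [y /setD1P[yx yA]] : exists y, y \in A :\ x.
      by apply/set0Pn; rewrite -card_gt0; lia.
    have [w wA xw] := conn_nbr cA xA yA ltac:(by rewrite eq_sym).
    apply/set0Pn; exists w; rewrite !inE xw wA !andbT.
    by apply: contraTneq xw => ->; rewrite edge_irrefl.
  by move=> z /setD1P[_ zA]; split; [apply: nc | apply: deg].
by split=> //; case: (pendant_leaf_or_cycle pd) => //; lia.
Qed.

End Structure.

(** * Maximum independent sets that avoid a vertex *)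

Section Avoiding.
Local Open Scope ring_scope.
Variable G : sgraph.
Implicit Types (A B C K M R S U W : {set G}) (u v w x y z : G).

(** Exchanging one component at a time would make a maximum independent set of
    [M :\ u] avoid all the neighbours of [u], and then [u] could be added. *)
Lemma avoiding_forced M u : u \in M -> (0 < avoiding M [set u])%N ->
  (forall w w', w \in nbrs M u -> w' \in nbrs M u -> w != w' ->
     ~~ connect (edge_in (M :\ u)) w w') ->
  exists2 w, w \in nbrs M u & forall S, S \in mis (M :\ u) -> w \in S.
Proof.
move=> uM /card_gt0P[S0]; rewrite inE disjoint_sym disjoints1 => /andP[HS0 uS0] sepN.
have HS0' := mis_without HS0 uS0.
case: (arg_minnP (fun S : {set G} => #|S :&: nbrs M u|) HS0') => S HS mn.
have [SN|/set0Pn[w]] := eqVneq (S :&: nbrs M u) set0.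
  have [I0 _ mx] := misP _ _ HS0.
  have uS : u \notin S by apply/negP => /(subsetP (mis_sub HS)); rewrite !inE eqxx.
  have := mx (u |: S); rewrite cardsU1 uS (mis_card HS HS0') add1n ltnn.
  move=> H; suff: false by []; apply: H.
    apply: independentU1 (mis_ind HS) _ => y yS; apply/negP => uy.
    have /setP/(_ y) := SN; rewrite !inE yS uy andbT /=.
    by have /setD1P[_ ->] := subsetP (mis_sub HS) y yS.
  by rewrite subUset sub1set uM (subset_trans (mis_sub HS)) // subD1set.
rewrite in_setI => /andP[wS wN]; exists w => // S' HS'.
apply/negPn/negP => wS'; set D := component (M :\ u) w.
have sepD : separated D ((M :\ u) :\: D).
  by apply: closed_separated; apply: component_closed.
have HS'' := mis_swap (component_sub _ _) sepD HS HS'.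
have := mn _ HS''; rewrite leqNgt => /negP; apply.
have wM : w \in M :\ u by apply: subsetP wS; apply: mis_sub.
apply/proper_card/properP; split; last first.
  by exists w; rewrite !inE ?wS ?(negPf wS') ?inE ?connect0 -?in_nbrs ?wN // -in_setD1 wM.
apply/subsetP => z /setIP[/setUP[/setDP[zS _]|/setIP[zS' zD]] zN].
  by rewrite inE zS.
have [zw|zw] := eqVneq z w; first by rewrite -zw zS' in wS'.
have := sepN w z wN zN; rewrite eq_sym => /(_ zw).
by move: zD; rewrite inE => /andP[_ ->].
Qed.

(** If removing [u] destroys a cycle, the general bound for one cycle less
    applies; otherwise [u] has at most one neighbour in each component, and one
    of these is forced, so that two vertices are removed. *)
Lemma avoiding_le M u q : conn M -> u \in M -> (ncyc M <= q.+1)%N ->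
  ~~ odd (#|M| + q) -> (avoiding M [set u])%:R <= lam q * gbound #|M| q.
Proof.
move=> cM uM leq ev.
have cM1 : #|M| = #|M :\ u|.+1 by rewrite (cardsD1 u M) uM.
rewrite cM1 -gbound_pred -?cM1 //.
have [le|lt] := leqP (ncyc (M :\ u)) q.
  apply: le_trans (mu_le (leqnn _) le).
  by rewrite ler_nat; apply: avoiding_mu.
have [->|av0] := posnP (avoiding M [set u]); first exact: ltW (gbound_gt0 _ _).
have [|w wN Hw] := avoiding_forced uM av0.
  move=> w w' wN w'N ww'; apply/negP => con; have := ncycS (subD1set M u).
  move: (wN) (w'N); rewrite !inE => /andP[wM uw] /andP[w'M uw'].
  have nu v : edge u v -> v != u by apply: contraTneq => ->; rewrite edge_irrefl.
  have := @ncyc_two_nbrs _ (M :\ u) u w w'; rewrite setD1K //.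
  rewrite !inE eqxx !nu //= => /(_ isT wM w'M ww' uw uw' con); lia.
have wM : w \in M :\ u.
  move: wN; rewrite !inE => /andP[-> uw]; rewrite andbT.
  by apply: contraTneq uw => ->; rewrite edge_irrefl.
have cM2 : #|M :\ u| = #|M :\ u :\ w|.+1 by rewrite (cardsD1 w (M :\ u)) wM.
apply: (@le_trans _ _ (mu ((M :\ u) :\: (w |: nbrs (M :\ u) w)))%:R).
  rewrite ler_nat; apply: leq_trans (mu_with _ _).
  apply/subset_leq_card/subsetP => S; rewrite !inE disjoint_sym disjoints1.
  by case/andP=> HS uS; have HS' := mis_without HS uS; rewrite HS' Hw.
apply: (@le_trans _ _ (gbound #|M :\ u :\ w| q.+1)).
  apply: mu_le; first by apply/subset_leq_card/setDU1_sub.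
  by apply: leq_trans leq; apply: ncycS; rewrite !setDDl subsetDl.
rewrite gbound_same; last by move: ev; rewrite cM1 cM2 !addSn /= negbK.
rewrite cM2; exact: gbound_monoSn.
Qed.

(** Each leaf, taken off with its neighbour, costs a factor two at most, and the
    path with three vertices, where this ends, has a single maximum independent
    set. *)
Lemma odd_tree M : conn M -> ncyc M = 0 -> odd #|M| -> (2 < #|M|)%N ->
  (mu M)%:R <= 1 / 2 * gbound #|M| 0.
Proof.
have [n] := ubnP #|M|; elim: n M => // n IH M /ltnSE leM' cM n0 oM M3.
have M0 : M != set0 by rewrite -card_gt0 ltnW // ltnW.
have deg y : y \in M -> conn (M :\ y) -> (#|nbrs M y| <= 1)%N.
  by move=> yM cy; have := ncyc_conn_vertex cy yM; rewrite n0; lia.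
have [w wM cw] : exists2 w, w \in M & ~~ conn (M :\ w).
  have [v vM cv] := noncut_exists cM M0.
  have [w wM vw] : exists2 w, w \in M & edge v w.
    have [y /setD1P[yv yM]] : exists y, y \in M :\ v.
      by apply/set0Pn; rewrite -card_gt0; have := cardsD1 v M; rewrite vM; lia.
    by apply: (conn_nbr cM vM yM); rewrite eq_sym.
  have nv : nbrs M v = [set w].
    by apply/eqP; rewrite eq_sym eqEcard sub1set inE wM vw cards1 deg.
  exists w => //; have [z] : exists z, z \in M :\: [set v; w].
    apply/set0Pn; rewrite -card_gt0 cardsD; have := cards2 v w.
    by have := subset_leq_card (subsetIr M [set v; w]); lia.
  rewrite !inE negb_or => /andP[/andP[zv zw] zM].
  exact: leaf_nbr_cut nv vM zM zv zw.
have [|x [K [pd alt]]] := pendant_structure cM wM cw.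
  by move=> y yM cy; apply: leq_trans (deg y yM cy) _.
have [xM KM cK cl _] := pd.
have [K1|K2] := pendant_leaf_or_cycle pd; last first.
  by have := pendant_cycle pd K2; rewrite n0.
set R := (M :\ x) :\: K in alt.
have cR : #|M| = #|R|.+2.
  by rewrite (cardsD1 x M) xM -(cardsID K (M :\ x)) (setIidPr KM) K1.
have nR : ncyc R = 0.
  have RM : R \subset M := subset_trans (subsetDl _ _) (subD1set _ _).
  by have := ncycS RM; rewrite n0 leqn0 => /eqP.
have muK : mu K = 1%N by move/eqP/cards1P: K1 => [y ->]; apply: mu1.
rewrite cR gboundSS.
case: alt => [[cR' R0 _]|xno]; last first.
  apply: (@le_trans _ _ (gbound #|R| 0)); last by lra.
  apply: le_trans (mu_le (leqnn _) (eq_leq nR)); rewrite ler_nat.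
  apply: (@leq_trans (mu (M :\ x))).
    apply/subset_leq_card/subsetP => S HS; apply: mis_without (HS) _; exact: xno.
  by have := mu_sep KM (pendant_separated pd); rewrite muK mul1n.
have H := mu_pendant pd; rewrite muK mul1n -/R in H.
have muN : mu (K :\: nbrs M x) = 1%N.
  have [y Ky] := cards1P (introT eqP K1).
  have [_ _ _ _ [/set0Pn[y' ]]] := pd; rewrite inE => /andP[y'K xy'] _ _.
  rewrite (_ : _ :\: _ = set0) ?mu0 //; apply/eqP; rewrite setD_eq0.
  move: y'K; rewrite Ky inE => /eqP Ey; rewrite sub1set inE -Ey xy' Ey andbT.
  by have := subsetP KM y; rewrite Ky set11 => /(_ isT)/setD1P[].
rewrite muN mul1n in H.
have [R3|R3] := ltnP 2 #|R|.
  have oR : odd #|R| by move: oM; rewrite cR /= negbK.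
  have leM : (mu M <= 2 * mu R)%N.
    by rewrite mul2n -addnn; apply: leq_trans H _; rewrite leq_add2l avoiding_le_mu.
  have ltR : (#|R| < n)%N by apply: leq_trans leM'; rewrite cR.
  have muR := IH R ltR cR' nR oR R3.
  apply: (@le_trans _ _ (2 * mu R)%:R); first by rewrite ler_nat.
  by rewrite natrM; lra.
have /cards1P[u Ru] : #|R| == 1%N by move: oM; rewrite cR /=; lia.
have xu : edge x u.
  have [|u'] := pendant_rest_attached (z := u) pd; rewrite -/R Ru ?inE //.
  by move=> /eqP->.
have uM : u \in M.
  have : u \in R by rewrite Ru set11.
  by rewrite !inE => /and3P[].
have av0 : avoiding R (nbrs M x) = 0%N.
  apply/eqP; rewrite cards_eq0 -subset0; apply/subsetP => S.
  rewrite inE Ru => /andP[/mis1->]; rewrite disjoints1 inE uM xu //.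
rewrite av0 addn0 in H.
apply: (@le_trans _ _ 1); first by have := H; rewrite Ru mu1 -(ler_nat rat).
by rewrite Ru cards1 /gbound.
Qed.

End Avoiding.

(** * The extremal graphs *)

Section Extremal.
Variable G : sgraph.
Implicit Types (A B C K M R S U W : {set G}) (u v w x y z c r k : G).

Definition clique K := forall x y, x \in K -> y \in K -> edge x y = (x != y).

Definition hung c r A K := [/\ [disjoint A & K], c \in A, r \in K, clique K &
  forall a k, a \in A -> k \in K -> edge a k = (a == c) && (k == r)].

(** The graph C(n, q) with centre [c], grown one clique at a time. The parameter
    [i] of a hung clique is the number of its cycles; since [i <= q], triangles
    are hung only if the first clique is a triangle. *)
Inductive extremal : nat -> G -> {set G} -> Prop :=
| ExtremalBase q c A : q <= 1 -> c \in A -> clique A -> #|A| = q.+2 ->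
    extremal q c A
| ExtremalHang q i c r A K : i <= 1 -> i <= q -> extremal q c A ->
    hung c r A K -> #|K| = i.+2 -> extremal (q + i) c (A :|: K).

Lemma clique_independent K S : clique K -> independent S -> S \subset K -> #|S| <= 1.
Proof.
move=> cK I SK; apply/card_le1P => x xS y; rewrite inE.
apply/idP/eqP => [yS|->//]; apply/eqP/negPn/negP => yx.
have := independentP _ I x y xS yS.
by rewrite cK ?(subsetP SK) // eq_sym yx.
Qed.

Lemma independent1 x : independent [set x].
Proof. by apply/independentP => a b /set1P-> /set1P->; rewrite edge_irrefl. Qed.

Lemma mis_clique K x : clique K -> x \in K -> [set x] \in mis K.
Proof.
move=> cK xK; apply/misP; split; first exact: independent1.
  by rewrite sub1set.
by move=> S' I' sub'; rewrite cards1; apply: clique_independent cK I' sub'.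
Qed.

Section Hung.
Variables (c r : G) (A K : {set G}).
Hypotheses (H : hung c r A K) (K2 : 1 < #|K|).

Lemma hung_notin k : k \in K -> k \notin A.
Proof. by case: H => dis _ _ _ _ kK; rewrite (disjointFl dis kK). Qed.

Lemma mis_hung_card S : independent S -> S \subset A :|: K ->
  exists2 B, B \in mis A & #|S| <= #|B|.+1.
Proof.
move=> I sub; have [B HB] := mis_ex A; exists B => //.
have [_ _ mx] := misP _ _ HB; have [_ _ _ cK _] := H.
rewrite -(cardsID K S) addnC -addn1 leq_add //.
  apply: mx; first exact: independentS (subsetDl _ _) I.
  by rewrite subDset setUC.
by apply: clique_independent cK (independentS (subsetIl _ _) I) (subsetIr _ _).
Qed.

Lemma mis_hung_add S k : S \in mis A -> k \in K -> (k == r) ==> (c \notin S) ->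
  k |: S \in mis (A :|: K).
Proof.
move=> HS kK /implyP kr; have [I sub mx] := misP _ _ HS; have [dis cA rK cK e] := H.
have kS : k \notin S by apply: contra (hung_notin kK); apply: (subsetP sub).
apply/misP; split.
- apply: independentU1 I _ => y yS; rewrite edge_sym e ?(subsetP sub) //.
  apply/negP => /andP[/eqP yc /kr]; by rewrite -yc yS.
- by rewrite subUset sub1set inE kK orbT (subset_trans sub) ?subsetUl.
- move=> S' I' /(mis_hung_card I')[B HB le]; rewrite cardsU1 kS add1n.
  by rewrite (mis_card HS HB).
Qed.

Lemma mis_hung_card_eq S B : S \in mis (A :|: K) -> B \in mis A -> #|S| = #|B|.+1.
Proof.
move=> HS HB; have [I sub mx] := misP _ _ HS.
have [k kK kr] : exists2 k, k \in K & k != r.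
  case/card_gt1P: K2 => x [y [xK yK xy]].
  by have [xr|] := eqVneq x r; [exists y; rewrite // -xr eq_sym | exists x].
have [B' HB' le] := mis_hung_card I sub.
apply/eqP; rewrite eqn_leq (mis_card HB HB') le /=.
have HkB : k |: B' \in mis (A :|: K) by apply: mis_hung_add; rewrite // (negPf kr).
have [I' sub' _] := misP _ _ HkB; apply: leq_trans (mx _ I' sub').
rewrite cardsU1 (_ : k \notin B') //.
by apply: contra (hung_notin kK); apply: (subsetP (mis_sub HB')).
Qed.

Lemma mis_hung_restrict S : S \in mis (A :|: K) ->
  S :&: A \in mis A /\ #|S :&: K| = 1.
Proof.
move=> HS; have [I sub mx] := misP _ _ HS; have [dis _ _ cK _] := H.
have [B HB] := mis_ex A; have cS := mis_hung_card_eq HS HB.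
have Sle : #|S :&: A| <= #|B|.
  by have [_ _] := misP _ _ HB; apply; rewrite ?subsetIr // (independentS (subsetIl _ _) I).
have Kle : #|S :&: K| <= 1.
  exact: clique_independent cK (independentS (subsetIl _ _) I) (subsetIr _ _).
have E : #|S| = #|S :&: A| + #|S :&: K|.
  rewrite -(cardsID A S); congr (_ + _); apply: eq_card => z; rewrite !inE.
  have [zS|] := boolP (z \in S); rewrite ?andbF // andbT.
  have := subsetP sub z zS; rewrite inE => /orP[zA|zK].
    by rewrite zA (disjointFr dis zA).
  by rewrite zK (disjointFl dis zK).
split; last by lia.
apply: (mis_of_card HB); rewrite ?subsetIr ?(independentS (subsetIl _ _) I) //; lia.
Qed.

(** A maximum independent set uses exactly one vertex [k] of the hung clique,
    and only the root restricts what may be used in [A]. *)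
Lemma hung_fiber (P : pred {set G}) k : k \in K ->
  #|[set S in mis (A :|: K) | (k \in S) && P (S :&: A)]| =
  #|[set S in mis A | P S && ((k == r) ==> (c \notin S))]|.
Proof.
move=> kK; have kA := hung_notin kK; have [dis cA rK cK e] := H.
have capA S : S \in mis A -> (k |: S) :&: A = S.
  move=> /mis_sub sub; rewrite setIUl (setIidPl sub) (_ : [set k] :&: A = set0) ?set0U //.
  by apply/setP => z; rewrite !inE; apply/negP => /andP[/eqP-> kA']; rewrite kA' in kA.
rewrite -[RHS](card_in_imset (f := fun S => k |: S)); last first.
  move=> S S'; rewrite !inE => /andP[HS _] /andP[HS' _] E.
  by rewrite -(capA S HS) -(capA S' HS') E.
apply: eq_card => S; rewrite inE; apply/and3P/imsetP => [[HS kS PS]|[B + ->]].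
  have [HB /eqP/cards1P[k' SK]] := mis_hung_restrict HS.
  have Ek : k' = k by apply/esym/set1P; rewrite -SK inE kS.
  exists (S :&: A); last first.
    have sub := mis_sub HS; apply/setP => z; rewrite !inE.
    have [->|zk] := eqVneq z k; first by rewrite kS.
    have [zS|//] := boolP (z \in S); rewrite /=.
    have := subsetP sub z zS; rewrite inE => /orP[->//|zK].
    have : z \in [set k'] by rewrite -SK inE zS.
    by rewrite Ek inE (negPf zk).
  rewrite inE HB PS /=; apply/implyP => /eqP kr; rewrite inE cA andbT.
  apply/negP => cS; have := independentP _ (mis_ind HS) c k cS kS.
  by rewrite e // kr !eqxx.
rewrite inE => /and3P[HB PB cB].
by rewrite mis_hung_add // setU11 capA.
Qed.

Lemma hung_count (P : pred {set G}) :
  #|[set S in mis (A :|: K) | P (S :&: A)]| =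
  #|K|.-1 * #|[set S in mis A | P S]| + #|[set S in mis A | P S && (c \notin S)]|.
Proof.
have [_ _ rK _ _] := H.
transitivity (\sum_(k in K)
    #|[set S in mis (A :|: K) | (k \in S) && P (S :&: A)]|).
  rewrite -sum1_card (eq_bigr (fun S : {set G} => \sum_(k in K) (k \in S))); last first.
    move=> S; rewrite inE => /andP[/mis_hung_restrict[_ E1] _].
    rewrite -E1 -sum1_card big_mkcond [RHS]big_mkcond /=; apply: eq_bigr => k _.
    by rewrite inE; case: (k \in S); case: (k \in K).
  rewrite exchange_big /=; apply: eq_bigr => k _.
  rewrite -sum1_card big_mkcond [RHS]big_mkcond /=; apply: eq_bigr => S _.
  by rewrite !inE; case: (k \in S); rewrite ?andbF //=; case: ifP.
rewrite (bigD1 r) //= hung_fiber // eqxx /= addnC; congr (_ + _).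
rewrite (eq_bigr (fun _ => #|[set S in mis A | P S]|)).
  rewrite sum_nat_const (cardsD1 r K) rK; congr (_ * _); apply: eq_card => k.
  by rewrite !inE andbC.
move=> k /andP[kK kr]; rewrite hung_fiber //.
by apply: eq_card => S; rewrite !inE (negPf kr) /= andbT.
Qed.

End Hung.

Lemma mis_cliqueE K S : clique K -> S \in mis K -> K != set0 ->
  exists2 x, x \in K & S = [set x].
Proof.
move=> cK HS /set0Pn[x xK].
have /eqP/cards1P[y Sy] : #|S| = 1.
  by rewrite (mis_card HS (mis_clique cK xK)) cards1.
by exists y => //; have := mis_sub HS; rewrite Sy sub1set.
Qed.

Lemma count_clique K c : clique K -> c \in K ->
  #|[set S in mis K | c \in S]| = 1 /\ avoiding K [set c] = #|K|.-1.
Proof.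
move=> cK cIK; have K0 : K != set0 by apply/set0Pn; exists c.
split.
  apply/eqP/cards1P; exists [set c]; apply/setP => S; rewrite inE in_set1.
  apply/andP/eqP => [[/(mis_cliqueE cK)/(_ K0)[x _ ->]]|->].
    by rewrite inE => /eqP->.
  by rewrite set11 mis_clique.
rewrite avoiding1E (cardsD1 c K) cIK add1n /=.
rewrite -(card_imset _ (@set1_inj G)); apply: eq_card => S; rewrite inE.
apply/andP/imsetP => [[/(mis_cliqueE cK)/(_ K0)[x xK ->]]|[x + ->]].
  by rewrite inE eq_sym => xc; exists x; rewrite // !inE xc.
by rewrite !inE eq_sym => /andP[xc xK]; rewrite xc mis_clique.
Qed.

Local Open Scope ring_scope.

Lemma extremal_center q c A : extremal q c A -> c \in A.
Proof. by elim=> // {}q i {}c r {}A K _ _ _ cA _ _; rewrite inE cA. Qed.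

Lemma hung_cardU c r A K : hung c r A K -> #|A :|: K| = (#|A| + #|K|)%N.
Proof. by case=> dis _ _ _ _; rewrite cardsU (disjoint_setI0 dis) cards0 subn0. Qed.

Lemma epsS q : eps q.+2 = 2 * eps q.+1.
Proof. by rewrite /eps /= !subn1 /= exprS. Qed.

(** Hanging a clique multiplies the sets that avoid the centre by its order, and
    those that contain the centre by one less, since these cannot use the
    root. *)
Lemma extremal_counts q c A : extremal q c A ->
  [/\ ~~ odd (#|A| + q), (avoiding A [set c])%:R = lam q * gbound #|A| q
    & (#|[set S in mis A | c \in S]|)%:R = eps q].
Proof.
elim=> {q c A} [q c A q1 cA clA cardA|q i c r A K i1 iq _ [ev av wi] hg cK].
  have [-> ->] := count_clique clA cA; rewrite cardA.
  by case: q q1 {cardA} => [|[|q]] // _; split.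
have K2 : (1 < #|K|)%N by rewrite cK.
have cA : c \in A by case: hg.
have -> : avoiding (A :|: K) [set c] = (#|K| * avoiding A [set c])%N.
  have /= := hung_count hg K2 (fun S : {set G} => c \notin S).
  rewrite avoiding1E (eq_card (B := [set S in mis (A :|: K) | c \notin S :&: A])).
    move=> ->; rewrite -avoiding1E (eq_card (B := [set S in mis A | c \notin S])).
      by rewrite -avoiding1E; lia.
    by move=> S; rewrite !inE andbb.
  by move=> S; rewrite !inE cA andbT.
have -> : #|[set S in mis (A :|: K) | c \in S]| =
    (#|K|.-1 * #|[set S in mis A | c \in S]|)%N.
  have /= := hung_count hg K2 (fun S : {set G} => c \in S).
  rewrite (eq_card (B := [set S in mis (A :|: K) | c \in S])).
    move=> ->; rewrite [X in (_ + X)%N = _](_ : _ = 0%N) ?addn0 //.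
    by apply/eqP; rewrite cards_eq0; apply/eqP/setP => S; rewrite !inE andbN andbF.
  by move=> S; rewrite !inE cA andbT.
rewrite (hung_cardU hg) cK !natrM av wi.
case: i i1 iq cK => [|[|i]] // _ iq cK.
  rewrite !addnS !addn0 addSn gboundSS /= negbK; split=> //; first ring.
  by rewrite mul1r.
case: q iq {av wi} ev => [|q] // _ ev.
have -> : (#|A| + 3 = (#|A|.+1).+2)%N by rewrite !addnS addn0.
rewrite addn1 gboundSS gbound_diag // epsS; split=> //.
- by move: ev; rewrite !addSn !addnS /= !negbK.
- by rewrite /lam /=; lra.
Qed.

Lemma extremal_mu q c A : extremal q c A -> (mu A)%:R = hbound #|A| q.
Proof.
move=> /extremal_counts[_ av wi].
by rewrite (mu_split A c) -avoiding1E natrD av wi.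
Qed.

Lemma extremal_avoiding_gt0 q c A : extremal q c A -> (0 < avoiding A [set c])%N.
Proof.
move=> /extremal_counts[_ av _]; rewrite -(ltr_nat rat) av.
apply: mulr_gt0; last exact: gbound_gt0.
by have := lam_ge q; lra.
Qed.

Lemma extremal_uses q c A u : extremal q c A -> u \in A -> u != c ->
  exists S, [/\ S \in mis A, u \in S & c \notin S].
Proof.
move=> ext; elim: ext u => {q c A} [q c A _ cA clA _ u uA uc|q i c r A K _ _ ext IH hg cK u].
  by exists [set u]; rewrite mis_clique // set11 inE eq_sym uc.
have [dis cA rK clK e] := hg.
have cNk k : k \in K -> c != k.
  by move=> kK; apply: contraNneq (hung_notin hg kK) => <-.
rewrite inE => /orP[uA|uK] uc.
  have [S [HS uS cS]] := IH u uA uc; exists (r |: S).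
  by rewrite (mis_hung_add hg) ?cS ?implybT // !inE uS orbT (negPf (cNk _ rK)).
have := extremal_avoiding_gt0 ext; rewrite avoiding1E => /card_gt0P[S].
rewrite inE => /andP[HS cS]; exists (u |: S).
by rewrite (mis_hung_add hg) ?cS ?implybT // setU11 !inE (negPf (cNk _ uK)).
Qed.

(** Sets avoiding the centre outnumber those containing it, by the factor that
    hanging one more triangle would need; with equality only for one clique. *)
Lemma extremal_balance q c A : extremal q c A ->
  (minn q 1).+1%:R * eps q <= (avoiding A [set c])%:R /\
  ((minn q 1).+1%:R * eps q < (avoiding A [set c])%:R \/
   [/\ (q <= 1)%N, clique A & #|A| = q.+2]).
Proof.
elim=> {q c A} [q c A q1 cA clA cardA|q i c r A K i1 iq ext [IH _] hg cK].
  split; last by right.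
  have [_ ->] := count_clique clA cA; rewrite cardA.
  by case: q q1 {cardA} => [|[|q]].
have [_ av _] := extremal_counts ext.
have [_ av' _] := extremal_counts (ExtremalHang i1 iq ext hg cK).
have g0 := gbound_gt0 #|A| q; have e0 := eps_gt0 q.
have [ev _ _] := extremal_counts ext.
suff lt : (minn (q + i) 1).+1%:R * eps (q + i) < (avoiding (A :|: K) [set c])%:R.
  by split; [apply: ltW | left].
rewrite av in IH; rewrite av' (hung_cardU hg) cK.
case: i i1 iq cK {av'} => [|[|i]] // _ iq cK.
  rewrite addn0 !addnS addn0 gboundSS; case: q IH {ext av ev iq} g0 e0 => [|q] /=.
    by rewrite /lam /=; lra.
  by rewrite /lam /= minnSS minn0 /=; lra.
case: q iq IH {ext av} ev g0 e0 => [//|q] _ IH ev g0 e0.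
have -> : (#|A| + 3 = (#|A|.+1).+2)%N by rewrite !addnS addn0.
rewrite addn1 gboundSS (gbound_diag ev) epsS; move: IH.
by rewrite /lam /= !minnSS !minn0 /=; lra.
Qed.

(** A vertex that lies in no more maximum independent sets than the centre is
    itself a centre. If it differs from [c] and there are several cliques, it is the
    root of the one hung last, and then the whole graph is two cliques of
    equal size joined by an edge, which may exchange their roles. *)
Lemma extremal_other_center q c A u : extremal q c A -> u \in A ->
  eps q < (#|[set S in mis A | u \in S]|)%:R \/ extremal q u A.
Proof.
move=> ext; elim: ext u => {q c A} [q c A q1 cA clA cardA u uA|q i c r A K i1 iq ext IH hg cK u].
  by right; apply: ExtremalBase.
have [dis cA rK clK e] := hg; have K2 : (1 < #|K|)%N by rewrite cK.
have e0 := eps_gt0 q.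
have epsE : eps (q + i) = i.+1%:R * eps q.
  case: i i1 iq cK => [|[|i]] // _ iq _; first by rewrite addn0 mul1r.
  by case: q iq {ext IH e0} => // q _; rewrite addn1 epsS.
rewrite inE => /orP[uA|uK].
  have [->|uc] := eqVneq u c; first by right; apply: ExtremalHang hg cK.
  left; have /= := hung_count hg K2 (fun S : {set G} => u \in S).
  rewrite (eq_card (B := [set S in mis (A :|: K) | u \in S])); last first.
    by move=> S; rewrite !inE uA andbT.
  move=> ->; rewrite epsE cK natrD natrM /=.
  have -> : i.+1%:R * eps q < i.+1%:R * (#|[set S in mis A | u \in S]|)%:R +
      (#|[set S in mis A | (u \in S) && (c \notin S)]|)%:R; last by [].
  have [S [HS uS cS]] := extremal_uses ext uA uc.
  have : (0 : rat) < (#|[set S in mis A | (u \in S) && (c \notin S)]|)%:R.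
    by rewrite ltr0n; apply/card_gt0P; exists S; rewrite inE HS uS.
  have : eps q <= (#|[set S in mis A | u \in S]|)%:R.
    by case: (IH u uA) => [/ltW//|/extremal_counts[_ _ ->]].
  have : (0 : rat) < i.+1%:R by [].
  nra.
have /= fib := hung_fiber hg K2 (fun _ => true) uK.
rewrite (eq_card (B := [set S in mis (A :|: K) | u \in S])) in fib; last first.
  by move=> S; rewrite !inE andbT.
have [bal alt] := extremal_balance ext; have [_ av wi] := extremal_counts ext.
rewrite fib epsE; have [ur|ur] := eqVneq u r; last first.
  left; have -> : #|[set S in mis A | true && (false ==> (c \notin S))]| = mu A.
    by apply: eq_card => S; rewrite inE andbT.
  have av0 : 0 < (avoiding A [set c])%:R :> rat.
    by rewrite ltr0n; apply: extremal_avoiding_gt0 ext.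
  rewrite (mu_split A c) -avoiding1E natrD wi.
  case: i i1 iq cK {epsE fib} => [|[|i]] // _ iq cK; first by lra.
  by case: q iq {ext IH} bal {alt av} e0 wi => // q _; rewrite minnSS minn0; lra.
have -> : #|[set S in mis A | true && (true ==> (c \notin S))]| = avoiding A [set c].
  by rewrite avoiding1E.
have [qi|qi] := eqVneq i (minn q 1); last first.
  have {qi} [i0 q0] : i = 0%N /\ (0 < q)%N by lia.
  left; move: bal; rewrite i0 (_ : minn q 1 = 1%N); last by lia.
  by move=> /= bal; lra.
case: alt => [lt|[q1 clA cA']]; first by left; rewrite qi.
have {qi} qi : i = q by lia.
subst i; right; rewrite setUC ur; apply: (ExtremalHang (r := c) (K := A)) => //.
  exact: ExtremalBase.
split=> //; first by rewrite disjoint_sym.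
by move=> a k aK kA; rewrite edge_sym e // andbC.
Qed.

(** A second vertex of [U] would lie in some maximum independent set that avoids
    the first one, so avoiding both would be rarer. *)
Lemma extremal_avoiding q c A U : extremal q c A -> U \subset A -> U != set0 ->
  lam q * gbound #|A| q <= (avoiding A U)%:R ->
  exists2 u, U = [set u] & extremal q u A.
Proof.
move=> ext UA /set0Pn[u uU] le; have uA := subsetP UA u uU.
have subU : [set u] \subset U by rewrite sub1set.
have extu : extremal q u A.
  have [lt|//] := extremal_other_center ext uA; exfalso.
  have := extremal_mu ext; rewrite /hbound (mu_split A u) -avoiding1E natrD.
  have := avoidingS A subU; rewrite -(ler_nat rat); lra.
exists u => //; apply/eqP; rewrite eqEsubset subU andbT; apply/subsetP => z zU.
rewrite inE; apply/negPn/negP => zu.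
have [S [HS zS uS]] := extremal_uses extu (subsetP UA z zU) zu.
have [_ av _] := extremal_counts extu; rewrite -av ler_nat leqNgt in le.
case/negP: le; apply/proper_card/properP; split.
  apply/subsetP => B; rewrite !inE => /andP[-> /(disjointWr subU)->] //.
exists S; rewrite !inE HS /=; first by rewrite disjoint_sym disjoints1.
by apply/negP => dis; have := disjointFr dis zS; rewrite zU.
Qed.

End Extremal.

(** * The bound for connected graphs *)

Section BoundInequalities.
Local Open Scope ring_scope.

Lemma gbound_double m b j : gbound (m + j.*2) b = 2 ^+ j * gbound m b.
Proof.
elim: j => [|j IH]; first by rewrite addn0 mul1r.
by rewrite doubleS !addnS gboundSS IH exprS mulrA.
Qed.

Lemma pow2_ge1 j : 1 <= 2 ^+ j :> rat.
Proof. by apply: exprn_ege1. Qed.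

Lemma gbound0_even j : gbound j.*2 0 = 2 ^+ j.
Proof. by have := gbound_double 0 0 j; rewrite add0n => ->; rewrite /gbound /= mulr1. Qed.

Lemma gbound0_odd j : gbound j.*2.+1 0 = 2 ^+ j.
Proof. by have := gbound_double 1 0 j; rewrite add1n => ->; rewrite /gbound /= mulr1. Qed.

Lemma hbound0_even j : hbound j.*2.+2 0 = 2 ^+ j + 1.
Proof. by rewrite /hbound -doubleS gbound0_even exprS /lam /eps /=; lra. Qed.

Lemma hbound1_odd j : hbound j.*2.+3 1 = 2 * 2 ^+ j + 1.
Proof.
have g3 : gbound 3 1 = 3 by rewrite /gbound /=; lra.
have := gbound_double 3 1 j; rewrite g3 /hbound !addSn add0n => ->.
by rewrite /lam /eps /=; lra.
Qed.

Lemma hboundSS n q : hbound n q < hbound n q.+2.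
Proof.
have g0 := gbound_gt0 n q; have e0 := eps_gt0 q.
have gm : gbound n q <= gbound n q.+2 by apply: gbound_mono; lia.
case: q g0 e0 gm => [|q] g0 e0 gm; rewrite /hbound.
  by rewrite /lam /eps /= expr1; lra.
have e1 : eps q.+3 = 4 * eps q.+1 by rewrite !epsS; ring.
by rewrite e1 /lam /=; lra.
Qed.

Lemma hbound_lt n q k : hbound n q < hbound n (q + k.+1.*2).
Proof.
elim: k => [|k IH]; first by rewrite addn2 hboundSS.
by apply: lt_trans IH _; rewrite [k.+2.*2]doubleS !addnS hboundSS.
Qed.

Lemma deg3_inequality m p : odd (m + p) ->
  hbound m.+3 p + gbound m p < hbound m.+4 p.+1.
Proof.
move=> o; have ev : ~~ odd (m.+1 + p) by lia.
have ev3 : ~~ odd (m.+3 + p) by lia.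
rewrite /hbound (gbound_pred ev) (gbound_diag ev3) gboundSS.
have g0 := gbound_gt0 m.+1 p; have e0 := eps_gt0 p.
case: p g0 e0 {o ev ev3} => [|p] g0 e0; first by rewrite /lam /eps /=; lra.
by rewrite epsS /lam /=; lra.
Qed.

(** With this equality and the next one, hanging an edge or a triangle on the
    centre keeps the bound attained. *)
Lemma leaf_equality m q : hbound m q + lam q * gbound m q = hbound m.+2 q.
Proof. by rewrite /hbound gboundSS; ring. Qed.

Lemma triangle_equality m p : ~~ odd (m + p.+1) ->
  2 * hbound m p.+1 + lam p.+1 * gbound m p.+1 = hbound m.+3 p.+2.
Proof.
move=> ev; rewrite /hbound gboundSS (gbound_diag ev) epsS /lam /=; lra.
Qed.

(** The case of a pendant cycle with an even number [2 j + 2] of vertices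
    besides [x], where [J = 2 ^ j], and where [X] and [Y] count the maximum
    independent sets of the rest, all of them and those avoiding the
    neighbours of [x]. *)
Lemma even_cycle_inequality m p j (X Y : rat) : (0 < j)%N -> ~~ odd (m + p) -> (1 < m)%N ->
  X <= gbound m p -> X <= hbound m p -> Y <= lam p * gbound m p ->
  (2 ^+ j + 1) * X + 2 ^+ j * Y < hbound (m.+3 + j.*2) p.+1.
Proof.
case: j => [//|j] _ ev m1 Xg; rewrite /hbound (gbound_double m.+3) gboundSS (gbound_diag ev) => Xh Y1.
have J2 : 2 <= 2 ^+ j.+1 :> rat by rewrite exprS; have := pow2_ge1 j; lra.
have g0 := gbound_gt0 m p; have e0 := eps_gt0 p.
move: (2 ^+ j.+1) J2 => J J2.
case: p ev Xg Xh Y1 g0 e0 => [|p] ev Xg Xh Y1 g0 e0.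
  have g2 : 2 <= gbound m 0.
    by have := gbound_mono_n 0 m1; rewrite [gbound 2 0](gbound0_even 1).
  move: Xg Xh Y1 g2; rewrite /lam /eps /=; move: (gbound m 0) => g Xg Xh Y1 g2.
  have : (J + 1) * X <= (J + 1) * (1 / 2 * g + 1) by rewrite ler_pM2l //; lra.
  have : J * Y <= J * (1 / 2 * g) by rewrite ler_pM2l //; lra.
  have : 0 <= (J - 2) * (g - 2) by rewrite mulr_ge0 //; lra.
  lra.
move: Xg Xh Y1 g0; rewrite epsS /lam /=; move: (gbound m p.+1) => g Xg Xh Y1 g0.
(* neither bound on [X] suffices alone: [J] copies of [X] are bounded by
   [gbound], and the remaining one by [hbound] *)
have : J * X <= J * g by rewrite ler_pM2l //; lra.
have : J * Y <= J * (2 / 3 * g) by rewrite ler_pM2l //; lra.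
have : 0 <= (J - 2) * g by rewrite mulr_ge0 //; lra.
lra.
Qed.

Lemma triangle_inequality0 m (X Y : rat) : ~~ odd m -> (2 < m)%N ->
  X <= hbound m 0 -> Y <= lam 0 * gbound m 0 -> 2 * X + Y < hbound m.+3 1.
Proof.
move=> ev m2; have g4 : 4 <= gbound m 0.
  apply: le_trans (gbound_mono_n 0 (_ : 4 <= m)%N); last by lia.
  by rewrite (gbound0_even 2).
have ev0 : ~~ odd (m + 0) by rewrite addn0.
rewrite /hbound gboundSS (gbound_diag ev0) /lam /eps /=; lra.
Qed.

End BoundInequalities.

Section ConnectedBound.
Local Open Scope ring_scope.
Variable G : sgraph.
Implicit Types (A B C K M R S U W : {set G}) (u v w x y z c r : G).

(** Besides the extremal graphs, the pentagon attains the bound. All that the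
    induction needs to know about it is how seldom a vertex is avoided. *)
Variant bounded q A : Prop :=
| BoundedStrict of (mu A)%:R < hbound #|A| q
| BoundedExtremal c of extremal q c A
| BoundedPentagon of q = 1%N & #|A| = 5%N & mu A = 5%N &
    (forall u, u \in A -> (avoiding A [set u] <= 3)%N).

Lemma gbound51 : gbound 5 1 = 6.
Proof. by rewrite /gbound /=; lra. Qed.

Lemma pentagon_leaf (t : rat) : t <= 3%:R -> 5%:R + t < hbound 7 1.
Proof. by rewrite /hbound gboundSS gbound51 /lam /eps /=; lra. Qed.

Lemma pentagon_triangle (t : rat) : t <= 3%:R -> 2 * 5%:R + t < hbound 8 2.
Proof.
move=> t3; have <- := @triangle_equality 5 0 isT.
rewrite /hbound gbound51 /lam /eps /=; lra.
Qed.

Lemma edge_triangle (t : rat) : t < lam 0 * gbound 2 0 ->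
  2 * hbound 2 0 + t < hbound 5 1.
Proof.
rewrite (hbound0_even 0) (gbound0_even 1) /hbound gbound51 /lam /eps /=; lra.
Qed.

Lemma bounded_le q A : bounded q A -> (mu A)%:R <= hbound #|A| q.
Proof.
case=> [/ltW//|c /extremal_mu->//|-> -> -> _].
by rewrite /hbound gbound51 /lam /eps /=; lra.
Qed.

Lemma bounded_weaken q k A : bounded q A -> bounded (q + k.*2) A.
Proof.
case: k => [|k]; first by rewrite addn0.
by move=> b; constructor 1; apply: le_lt_trans (bounded_le b) (hbound_lt _ _ _).
Qed.

Lemma clique_pair K : conn K -> #|K| = 2%N -> clique K.
Proof.
move=> cK K2 x y xK yK; have [->|xy] := eqVneq x y; first exact: edge_irrefl.
have [z zK xz] := conn_nbr cK xK yK xy.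
have Kxy : K = [set x; y].
  by apply/esym/eqP; rewrite eqEcard subUset !sub1set xK yK cards2 xy K2.
move: zK; rewrite Kxy => /set2P[zx|<-//]; by rewrite zx edge_irrefl in xz.
Qed.

Lemma cliqueU1 K x : x \notin K -> clique K -> (forall y, y \in K -> edge x y) ->
  clique (x |: K).
Proof.
move=> xK cK xe y z /setU1P[->|yK] /setU1P[->|zK].
- by rewrite eqxx edge_irrefl.
- by rewrite xe //; symmetry; apply: contraNneq xK => ->.
- by rewrite edge_sym xe //; symmetry; apply: contraNneq xK => <-.
- exact: cK.
Qed.

Lemma hung_swap c r A K : hung c r A K -> clique A -> hung r c K A.
Proof.
case=> dis cA rK cK e clA; split=> //; first by rewrite disjoint_sym.
by move=> a k aK kA; rewrite edge_sym e // andbC.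
Qed.

Section PendantCase.
Variables (A K : {set G}) (x : G).
Hypothesis pd : pendant A x K.
Let R := (A :\ x) :\: K.

Lemma pendant_xK : x \notin K.
Proof. by case: pd => _ KA _ _ _; apply/negP => /(subsetP KA); rewrite !inE eqxx. Qed.

Lemma pendant_cardE : #|A| = (#|R| + #|K|).+1.
Proof.
case: pd => xA KA _ _ _.
by rewrite (cardsD1 x A) xA -(cardsID K (A :\ x)) (setIidPr KA) add1n addnC.
Qed.

Lemma pendant_decomp : A = R :|: (x |: K).
Proof.
case: pd => xA KA _ _ _; apply/setP => z; rewrite !inE.
have [->|zx] := eqVneq z x; first by rewrite xA orbT.
have [zK|zK] /= := boolP (z \in K); last by rewrite orbF.
by have /setD1P[_ ->] := subsetP KA z zK; rewrite ?orbT.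
Qed.

Lemma pendant_hung u : nbrs R x = [set u] -> clique (x |: K) -> hung u x R (x |: K).
Proof.
move=> nu cl; have [dis sep] := pendant_separated pd; split=> //.
- rewrite disjoint_sym disjoints_subset subUset sub1set !inE eqxx andbF /=.
  by apply/subsetP => z zK; rewrite !inE zK.
- by have := set11 u; rewrite -nu inE => /andP[].
- exact: setU11.
move=> a k aR /setU1P[->|kK].
  have : (a \in nbrs R x) = (a == u) by rewrite nu inE.
  by rewrite inE aR eqxx andbT edge_sym.
rewrite edge_sym (negPf (sep k a kK aR)) (_ : k == x = false) ?andbF //.
by apply: contraNF pendant_xK => /eqP <-.
Qed.

Lemma pendant_nbrs_rest : R != set0 -> nbrs R x != set0.
Proof.
case/set0Pn=> z /(pendant_rest_attached pd)[w wR xw].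
by apply/set0Pn; exists w; rewrite inE wR.
Qed.

Lemma pendant_avoiding : (avoiding R (nbrs A x) <= avoiding R (nbrs R x))%N.
Proof.
by apply: avoidingS; apply: nbrsS; apply: subset_trans (subsetDl _ _) (subD1set _ _).
Qed.

Lemma pendant_inner_card : (1 < #|nbrs K x|)%N -> (#|K :\: nbrs A x| <= #|K| - 2)%N.
Proof.
move=> K2; have KA : K \subset A.
  by case: pd => _ KA _ _ _; apply: subset_trans KA (subD1set _ _).
rewrite cardsD; apply: leq_sub2l; apply: leq_trans K2 _; apply: subset_leq_card.
apply/subsetP => z zN; rewrite inE (subsetP (nbrsS x KA) _ zN) andbT.
by move: zN; rewrite inE => /andP[].
Qed.

Lemma pendant_leaf_mu : #|K| = 1%N -> (mu A <= mu R + avoiding R (nbrs R x))%N.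
Proof.
move=> /eqP/cards1P[y Ky]; apply: leq_trans (mu_pendant pd) _.
rewrite [in X in (X * _ + _)%N]Ky mu1 mul1n leq_add2l (_ : K :\: _ = set0).
  by rewrite mu0 mul1n pendant_avoiding.
have [xA KA _ _ [/set0Pn[y' +] _ _]] := pd.
rewrite inE Ky inE => /andP[/eqP -> xy]; apply/eqP; rewrite setD_eq0 sub1set inE xy.
by have := subsetP KA y; rewrite Ky set11 => /(_ isT)/setD1P[_ ->].
Qed.

(** An unused vertex [x] can be deleted: that separates a leaf, or else it
    destroys a cycle. *)
Lemma unused_bounded q : (ncyc A <= q.+1)%N -> ~~ odd (#|A| + q) ->
  (forall S, S \in mis A -> x \notin S) -> bounded q A.
Proof.
move=> ncA ev no; constructor 1.
have [xA KA cK cl _] := pd; have g0 := gbound_gt0 #|A| q; have e0 := eps_gt0 q.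
have le1 : (mu A <= mu (A :\ x))%N.
  by apply/subset_leq_card/subsetP => S HS; apply: mis_without (HS) (no S HS).
have cA1 : #|A| = #|A :\ x|.+1 by rewrite (cardsD1 x A) xA.
have l0 := lam_ge q.
suff le2 : (mu (A :\ x))%:R <= lam q * gbound #|A| q.
  apply: (@le_lt_trans _ _ (mu (A :\ x))%:R); first by rewrite ler_nat.
  by rewrite /hbound; lra.
have [K1|K2] := pendant_leaf_or_cycle pd; last first.
  have leq : (ncyc (A :\ x) <= q)%N.
    by rewrite -ltnS; apply: leq_trans (pendant_cycle pd K2) ncA.
  by apply: le_trans (mu_le (leqnn _) leq) _; rewrite cA1 -gbound_pred // -cA1.
apply: (@le_trans _ _ (mu R)%:R).
  rewrite ler_nat; apply: leq_trans (mu_sep KA (pendant_separated pd)) _.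
  by have [y Ky] := cards1P (introT eqP K1); rewrite [in X in (X * _)%N]Ky mu1 mul1n.
have cR : #|A| = #|R|.+2 by rewrite pendant_cardE K1 addn1.
have nR : (ncyc R <= q.+1)%N.
  by apply: leq_trans ncA; apply: ncycS; apply: subset_trans (subsetDl _ _) (subD1set _ _).
apply: le_trans (mu_le (leqnn _) nR) _.
rewrite cR gboundSS gbound_same; last by move: ev; rewrite cR !addSn /= negbK.
by have := gbound_gt0 #|R| q; move: l0; nra.
Qed.

Hypotheses (cR : conn R) (R0 : R != set0).

Lemma rest_vertex : exists2 u, u \in R & [set u] \subset nbrs R x.
Proof.
have /set0Pn[u uN] := pendant_nbrs_rest R0; exists u; last by rewrite sub1set.
by move: uN; rewrite inE => /andP[].
Qed.

Lemma rest_avoiding q : (ncyc R <= q.+1)%N -> ~~ odd (#|R| + q) ->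
  (avoiding R (nbrs R x))%:R <= lam q * gbound #|R| q.
Proof.
move=> nR ev; have [u uR sub] := rest_vertex.
apply: le_trans (avoiding_le cR uR nR ev); rewrite ler_nat; exact: avoidingS.
Qed.

Lemma leaf_bounded q : #|K| = 1%N -> bounded q R -> (ncyc R <= q.+1)%N ->
  ~~ odd (#|R| + q) -> bounded q A.
Proof.
move=> K1 bR nR ev; have cA : #|A| = #|R|.+2 by rewrite pendant_cardE K1 addn1.
have leA : (mu A)%:R <= (mu R)%:R + (avoiding R (nbrs R x))%:R :> rat.
  by rewrite -natrD ler_nat pendant_leaf_mu.
have av := rest_avoiding nR ev; have [u uR subU] := rest_vertex.
case: (bR) => [lt|c ext|q1 R5 mu5 av3].
- constructor 1; rewrite cA -leaf_equality; apply: le_lt_trans leA _.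
  exact: ltr_leD lt av.
- have [le|lt] := lerP (lam q * gbound #|R| q) (avoiding R (nbrs R x))%:R; last first.
    constructor 1; rewrite cA -leaf_equality; apply: le_lt_trans leA _.
    exact: ler_ltD (bounded_le bR) lt.
  have subN : nbrs R x \subset R by apply/subsetP => z; rewrite inE => /andP[].
  have [u' nu extu] := extremal_avoiding ext subN (pendant_nbrs_rest R0) le.
  constructor 2 with u'; rewrite pendant_decomp -[q]addn0.
  have [y Ky] := cards1P (introT eqP K1).
  have xy : edge x y.
    by have [_ _ _ _ [/set0Pn[y' +] _ _]] := pd; rewrite inE Ky inE => /andP[/eqP->].
  have xK := pendant_xK.
  apply: (ExtremalHang _ _ extu (r := x)) => //; last by rewrite cardsU1 xK K1.
  apply: pendant_hung => //; apply: cliqueU1 => //.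
    by move=> a b; rewrite Ky !inE => /eqP-> /eqP->; rewrite edge_irrefl eqxx.
  by move=> z; rewrite Ky inE => /eqP->.
- constructor 1; apply: le_lt_trans leA _.
  have : (avoiding R (nbrs R x) <= 3)%N.
    exact: leq_trans (avoidingS _ subU) (av3 u uR).
  rewrite -(ler_nat rat) mu5 cA R5 q1; exact: pentagon_leaf.
Qed.

(** For a pendant triangle the bound is tight, and the triangle is hung on the
    centre of the rest; when the rest is a single edge the triangle becomes
    the first clique instead. *)
Lemma triangle_bounded p : #|K| = 2%N -> (1 < #|nbrs K x|)%N -> bounded p R ->
  (ncyc R <= p.+1)%N -> ~~ odd (#|R| + p) ->
  (mu A)%:R <= 2 * (mu R)%:R + (avoiding R (nbrs R x))%:R :> rat ->
  bounded p.+1 A.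
Proof.
move=> K2 N2 bR nR ev leA.
have cA : #|A| = #|R|.+3 by rewrite pendant_cardE K2 addn2.
have av := rest_avoiding nR ev; have [u uR subU] := rest_vertex.
have subN : nbrs R x \subset R by apply/subsetP => z; rewrite inE => /andP[].
have NK : nbrs K x = K.
  apply/eqP; rewrite eqEcard K2 N2 andbT.
  by apply/subsetP => z; rewrite inE => /andP[].
have xK := pendant_xK.
have clK : clique (x |: K).
  apply: cliqueU1 => //; first by case: pd => _ _ cK _ _; apply: clique_pair.
  by move=> y; rewrite -NK inE => /andP[].
have c3 : #|x |: K| = 3%N by rewrite cardsU1 xK K2.
case: p bR nR ev av => [|p] bR nR ev av; rewrite ?addn0 in ev; last first.
  case: (bR) => [lt|c ext|[p1] R5 mu5 av3].
  - constructor 1; rewrite cA -(triangle_equality ev); apply: le_lt_trans leA _.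
    by apply: ltr_leD av; rewrite ltr_pM2l.
  - have [le|lt] := lerP (lam p.+1 * gbound #|R| p.+1) (avoiding R (nbrs R x))%:R; last first.
      constructor 1; rewrite cA -(triangle_equality ev); apply: le_lt_trans leA _.
      exact: ler_ltD (ler_wpM2l (ler0n _ 2) (bounded_le bR)) lt.
    have [u' nu extu] := extremal_avoiding ext subN (pendant_nbrs_rest R0) le.
    constructor 2 with u'; rewrite pendant_decomp -addn1.
    apply: (ExtremalHang _ _ extu (r := x)) => //; exact: pendant_hung.
  - constructor 1; apply: le_lt_trans leA _.
    have : (avoiding R (nbrs R x) <= 3)%N.
      exact: leq_trans (avoidingS _ subU) (av3 u uR).
    rewrite -(ler_nat rat) mu5 cA R5 p1; exact: pentagon_triangle.
have [R2|R2] := ltnP 2 #|R|.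
  constructor 1; rewrite cA; apply: le_lt_trans leA _.
  exact: triangle_inequality0 ev R2 (bounded_le bR) av.
have {}R2 : #|R| = 2%N.
  by move: R0; rewrite -card_gt0; move: R2 ev; lia.
have clR := clique_pair cR R2.
have extR : extremal 0 u R by apply: ExtremalBase.
have [le|lt] := lerP (lam 0 * gbound #|R| 0) (avoiding R (nbrs R x))%:R; last first.
  constructor 1; apply: le_lt_trans leA _.
  by move: lt; rewrite (extremal_mu extR) cA R2; apply: edge_triangle.
have [u' nu _] := extremal_avoiding extR subN (pendant_nbrs_rest R0) le.
constructor 2 with x; rewrite pendant_decomp setUC.
have ext1 : extremal 1 x (x |: K) by apply: ExtremalBase; rewrite ?setU11.
have hg := hung_swap (pendant_hung nu clK) clR.
exact: (@ExtremalHang _ 1 0 _ _ _ _ isT isT ext1 hg R2).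
Qed.

End PendantCase.

End ConnectedBound.

Section CyclesAndBranches.
Local Open Scope ring_scope.
Variable G : sgraph.
Implicit Types (A B C K M R S U W : {set G}) (u v w x y z c r : G).

(** A vertex of degree three or more takes two cycles away with it, and its
    neighbourhood leaves at most [#|A| - 4] vertices. *)
Lemma branch_bounded A v p : v \in A -> (2 < #|nbrs A v|)%N ->
  bounded p (A :\ v) -> (ncyc (A :\ v) <= p)%N -> ~~ odd (#|A| + p.+1) ->
  bounded p.+1 A.
Proof.
move=> vA d3 bA nA ev; constructor 1.
have ltA := nbrs_lt vA; have cAN := card_nbrsD vA.
have cA1 : #|A| = #|A :\ v|.+1 by rewrite (cardsD1 v A) vA.
have [m Em] : exists m, #|A| = m.+4 by exists (#|A| - 4)%N; lia.
have b1 := bounded_le bA; have {}cA1 : #|A :\ v| = m.+3 by lia.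
have b2 : (mu (A :\: (v |: nbrs A v)))%:R <= gbound m p.
  by apply: mu_le; [lia | apply: leq_trans (ncycS (setDU1_sub A v)) nA].
have := mu_vertex A v; rewrite -(ler_nat rat) natrD => le.
have := @deg3_inequality m p; rewrite Em; move: b1; rewrite cA1 => b1 H.
have {}H : hbound m.+3 p + gbound m p < hbound m.+4 p.+1 by apply: H; lia.
exact: le_lt_trans le (le_lt_trans (lerD b1 b2) H).
Qed.

Lemma pendant_cycle_mu A x K j : pendant A x K -> (1 < #|nbrs K x|)%N ->
  (#|K| <= j.*2.+3)%N ->
  (mu A)%:R <= (mu K)%:R * (mu ((A :\ x) :\: K))%:R +
     2 ^+ j * (avoiding ((A :\ x) :\: K) (nbrs A x))%:R :> rat.
Proof.
move=> pd N2 Kj; have := mu_pendant pd; rewrite -(ler_nat rat) natrD !natrM.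
move=> le; apply: le_trans le _; rewrite lerD2l ler_wpM2r // -gbound0_odd.
apply: mu_le; first by have := pendant_inner_card pd N2; lia.
by rewrite -(pendant_ncyc0 pd) ncycS ?subsetDl.
Qed.

Lemma pendant_even_mu A x K j : pendant A x K -> (1 < #|nbrs K x|)%N ->
  #|K| = j.*2.+2 -> bounded 0 K ->
  (mu A)%:R <= (2 ^+ j + 1) * (mu ((A :\ x) :\: K))%:R +
     2 ^+ j * (avoiding ((A :\ x) :\: K) (nbrs A x))%:R :> rat.
Proof.
move=> pd N2 Kj bK; have := @pendant_cycle_mu _ _ _ j pd N2; rewrite Kj => /(_ (leqnSn _)).
move=> le; apply: le_trans le _; rewrite lerD2r ler_wpM2r //.
by have := bounded_le bK; rewrite Kj hbound0_even.
Qed.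

Lemma pendant_odd_mu A x K j : pendant A x K -> (1 < #|nbrs K x|)%N ->
  #|K| = j.*2.+3 ->
  (mu A)%:R <= 2 ^+ j * (mu ((A :\ x) :\: K))%:R +
     2 ^+ j * (avoiding ((A :\ x) :\: K) (nbrs A x))%:R :> rat.
Proof.
move=> pd N2 Kj; have := pendant_cycle_mu pd N2 (eq_leq Kj).
have [_ _ cK _ _] := pd; have nK := pendant_ncyc0 pd.
move=> le; apply: le_trans le _; rewrite lerD2r ler_wpM2r //.
have := odd_tree cK nK; rewrite Kj /= odd_double.
by rewrite -doubleS gbound0_odd exprS; move=> /(_ isT isT); lra.
Qed.

(** For an odd path [odd_tree] halves the count, and without its ends the path
    has no more; so the general bound for the rest is enough. *)
Lemma odd_cycle_bounded A x K q j : pendant A x K -> (1 < #|nbrs K x|)%N ->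
  #|K| = j.*2.+3 -> (ncyc ((A :\ x) :\: K) <= q)%N -> ~~ odd (#|A| + q) ->
  bounded q A.
Proof.
move=> pd N2 Kj nR ev; constructor 1.
have le := pendant_odd_mu pd N2 Kj; have cA := pendant_cardE pd.
have := mu_le (leqnn _) nR; have := avoiding_le_mu ((A :\ x) :\: K) (nbrs A x).
set R := _ :\: K in le cA nR *; rewrite -(ler_nat rat) => av muR.
have {}cA : #|A| = (#|R|.+4 + j.*2)%N by rewrite cA Kj; lia.
rewrite cA /hbound gbound_double !gboundSS.
have J1 := pow2_ge1 j; have g0 := gbound_gt0 #|R| q; have e0 := eps_gt0 q.
have l0 := lam_ge q.
move: (2 ^+ j) J1 le => J J1 le.
have : J * (mu R)%:R <= J * gbound #|R| q by rewrite ler_pM2l //; lra.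
have : J * (avoiding R (nbrs A x))%:R <= J * (mu R)%:R by rewrite ler_pM2l //; lra.
have : 0 <= (lam q - 1 / 2) * (J * gbound #|R| q).
  by apply: mulr_ge0; [lra | apply: mulr_ge0; lra].
lra.
Qed.

(** If the only cycle passes through [x] and [K], the rest is a tree of odd
    order, and [odd_tree] saves a factor two on it. *)
Lemma unicyclic_bounded A x K j : pendant A x K -> (1 < #|nbrs K x|)%N ->
  #|K| = j.*2.+2 -> bounded 0 K -> conn ((A :\ x) :\: K) ->
  ncyc ((A :\ x) :\: K) = 0 -> (2 < #|(A :\ x) :\: K|)%N -> ~~ odd #|A| ->
  bounded 0 A.
Proof.
move=> pd N2 Kj bK cR nR R3 ev; constructor 1.
have le := pendant_even_mu pd N2 Kj bK; have cA := pendant_cardE pd.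
have av := avoiding_le_mu ((A :\ x) :\: K) (nbrs A x).
set R := _ :\: K in le cA nR R3 cR av *.
have oR : odd #|R| by move: ev; rewrite cA Kj; lia.
have tR := odd_tree cR nR oR R3.
have {}cA : #|A| = (#|R|.+1.+2 + j.*2)%N by rewrite cA Kj; lia.
have gR : gbound #|R| 0 = 1 / 2 * gbound #|R|.+1 0 by rewrite (@gbound_pred #|R|) ?addn0 //= oR.
rewrite cA /hbound gbound_double gboundSS /lam /eps /=.
move: av; rewrite -(ler_nat rat) => av; rewrite gR in tR.
have J1 := pow2_ge1 j; have g0 := gbound_gt0 #|R|.+1 0.
move: (2 ^+ j) J1 le (gbound _ 0) g0 tR => J J1 le g g0 tR.
have : J * (mu R)%:R <= J * (1 / 2 * (1 / 2 * g)) by rewrite ler_pM2l //; lra.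
have : J * (avoiding R (nbrs A x))%:R <= J * (mu R)%:R by rewrite ler_pM2l //; lra.
have : 0 <= (J - 1) * g by apply: mulr_ge0; lra.
lra.
Qed.

Lemma extremal0_degree c A : extremal 0 c A -> (#|nbrs A c|.*2 = #|A|)%N.
Proof.
move: {1 3}0%N (erefl 0%N) => q q0 ext.
elim: ext q0 => {q c A} [q c A _ cA clA cardA q0|q i c r A K _ iq ext IH hg cK qi].
  rewrite cardA q0; suff -> : nbrs A c = A :\ c.
    by have := cardsD1 c A; rewrite cA cardA q0; lia.
  by apply/setP => z; rewrite !inE andbC; case: (boolP (z \in A)) => zA; rewrite ?andbF //
    clA // !andbT eq_sym.
have [q0 i0] : q = 0%N /\ i = 0%N by lia.
rewrite (hung_cardU hg) cK i0 addn2 -IH // -doubleS; congr _.*2.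
have [dis cA rK _ e] := hg.
have -> : nbrs (A :|: K) c = r |: nbrs A c.
  apply/setP => z; rewrite !inE.
  have [zK|zK] := boolP (z \in K).
    by rewrite orbT (disjointFl dis zK) e // eqxx /= orbF.
  rewrite orbF; have [zr|//] := eqVneq z r; by rewrite zr rK in zK.
by rewrite cardsU1 inE (negPf (hung_notin hg rK)).
Qed.

(** A graph without cut vertices and of maximum degree two. Its bound depends
    on the parity of its order only; a larger [q] leaves room. *)
Lemma uncut_bounded A q : conn A -> A != set0 ->
  (forall y, y \in A -> conn (A :\ y)) ->
  (forall y, y \in A -> (#|nbrs A y| <= 2)%N) ->
  (forall y, y \in A -> ncyc (A :\ y) = 0 -> ~~ odd #|A :\ y| -> A :\ y != set0 ->
     bounded 0 (A :\ y)) ->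
  ~~ odd (#|A| + q) -> bounded q A.
Proof.
move=> cA /set0Pn[x xA] nc deg IH ev.
suff [q0 [k [qE b]]] : exists q0 k, q = (q0 + k.*2)%N /\ bounded q0 A.
  by rewrite qE; apply: bounded_weaken.
have e1 : odd #|A| -> q = (1 + (q./2).*2)%N by lia.
have e0 : ~~ odd #|A| -> q = (0 + (q./2).*2)%N by lia.
have A0 : (0 < #|A|)%N by rewrite card_gt0; apply/set0Pn; exists x.
have clq : (#|A| <= 3)%N -> (0 < #|A|.-1)%N -> clique A -> exists q0 k, q = (q0 + k.*2)%N /\ bounded q0 A.
  move=> A3 A1 clA; exists (#|A| - 2)%N, (q./2); split.
    by case: (boolP (odd #|A|)) => o; [rewrite [LHS]e1 // | rewrite [LHS]e0 //]; congr (_ + _)%N; lia.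
  by constructor 2 with x; apply: ExtremalBase => //; lia.
have [A1|A1] := leqP #|A| 1.
  have {}A1 : #|A| = 1%N by lia.
  exists 1%N, (q./2); split; first by apply: e1; rewrite A1.
  constructor 1; have /eqP/cards1P[y ->] := A1; rewrite mu1 cards1 /hbound.
  by have := gbound_gt0 1 1; rewrite /lam /eps /=; lra.
have [A2|A2] := leqP #|A| 2.
  by apply: clq; [lia | lia | apply: clique_pair => //; lia].
have cyc y : y \in A -> pendant A y (A :\ y) /\ (1 < #|nbrs (A :\ y) y|)%N.
  by move=> yA; apply: uncut_structure.
have [pd N2] := cyc x xA.
have nK := pendant_ncyc0 pd; have cA1 : #|A| = #|A :\ x|.+1 by rewrite (cardsD1 x A) xA.
have R0 : (A :\ x) :\: (A :\ x) = set0 by rewrite setDv.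
have av0 : (avoiding (set0 : {set G}) (nbrs A x) <= 1)%N.
  by apply: leq_trans (avoiding_le_mu _ _) _; rewrite mu0.
move: av0; rewrite -(ler_nat rat) => av0.
have [[k Ek]|[k Ek]] := parityP #|A :\ x|; last first.
  exists 0%N, (q./2); split; first by apply: e0; lia.
  constructor 1; case: k Ek => [|k] Ek; first by lia.
  have := pendant_odd_mu pd N2 Ek; rewrite R0 mu0 cA1 Ek.
  rewrite hbound0_even exprS; have J1 := pow2_ge1 k.
  have : 2 ^+ k * (avoiding set0 (nbrs A x))%:R <= 2 ^+ k :> rat.
    exact: ler_piMr (le_trans ler01 J1) av0.
  lra.
case: k Ek => [|k] Ek; first by lia.
have bK : bounded 0 (A :\ x).
  by apply: IH => //; [rewrite Ek; lia | rewrite -card_gt0; lia].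
have leA : (mu A)%:R <= hbound #|A| 1.
  have := pendant_even_mu pd N2 Ek bK; rewrite R0 mu0 cA1 Ek.
  rewrite -[k.+1.*2.+1]/(k.*2.+3) hbound1_odd.
  have : 2 ^+ k * (avoiding set0 (nbrs A x))%:R <= 2 ^+ k :> rat.
    exact: ler_piMr (le_trans ler01 (pow2_ge1 k)) av0.
  lra.
case: k Ek leA => [|[|k]] Ek leA.
- have NK : nbrs (A :\ x) x = A :\ x.
    apply/eqP; rewrite eqEcard Ek N2 andbT.
    by apply/subsetP => z; rewrite inE => /andP[].
  apply: clq; [by lia | by lia |]; rewrite -(setD1K xA); apply: cliqueU1.
  + by rewrite !inE eqxx.
  + by apply: clique_pair; [apply: nc | rewrite Ek].
  + by move=> y; rewrite -NK inE => /andP[].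
- exists 1%N, (q./2); split; first by apply: e1; lia.
  have A5 : #|A| = 5%N by rewrite cA1 Ek.
  have h5 : hbound 5 1 = 5 by rewrite /hbound gbound51 /lam /eps /=; lra.
  move: leA; rewrite le_eqVlt => /orP[/eqP eqA|lt]; last by constructor 1.
  have mu5 : mu A = 5%N by apply/eqP; rewrite -(eqr_nat rat) eqA A5 h5 eqxx.
  apply: (BoundedPentagon (erefl _) A5 mu5) => u uA.
  have [pu _] := cyc u uA; apply: leq_trans (avoiding_mu _ _) _.
  have cAu : #|A :\ u| = 4%N by have := cardsD1 u A; rewrite uA A5; lia.
  have b : bounded 0 (A :\ u).
    apply: (IH u uA (pendant_ncyc0 pu)); first by rewrite cAu.
    by rewrite -card_gt0 cAu.
  have := bounded_le b; rewrite cAu (hbound0_even 1) expr1 -(natrD _ 2 1).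
  by rewrite (ler_nat rat).
- exists 1%N, (q./2); split; first by apply: e1; lia.
  constructor 1; rewrite lt_neqAle leA andbT; apply/negP => /eqP eqA.
  (* equality would make the path [A :\ x] extremal, with a centre of degree at
     least three *)
  case: bK => [lt|c ext|]; last by [].
    have := @pendant_cycle_mu _ _ _ k.+2 pd N2; rewrite Ek => /(_ (leqnSn _)).
    move: lt; rewrite R0 mu0 eqA cA1 Ek -[k.+3.*2.+1]/(k.+2.*2.+3) hbound1_odd.
    rewrite -[k.+3.*2]/(k.+2.*2.+2) hbound0_even.
    have : 2 ^+ k.+2 * (avoiding set0 (nbrs A x))%:R <= 2 ^+ k.+2 :> rat.
      exact: ler_piMr (le_trans ler01 (pow2_ge1 k.+2)) av0.
    lra.
  have dc := extremal0_degree ext; rewrite Ek in dc.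
  have := subset_leq_card (nbrsS c (subD1set A x)).
  have /setD1P[_ cIA] := extremal_center ext; have := deg c cIA; lia.
Qed.

End CyclesAndBranches.

Section ConnectedInduction.
Local Open Scope ring_scope.
Variable G : sgraph.
Implicit Types (A B C K M R S U W : {set G}) (u v w x y z c r : G).

Lemma even_cycle_bounded A x K p j : pendant A x K -> (1 < #|nbrs K x|)%N ->
  #|K| = j.*2.+2 -> bounded 0 K -> conn ((A :\ x) :\: K) ->
  (A :\ x) :\: K != set0 -> (1 < #|(A :\ x) :\: K|)%N ->
  bounded p ((A :\ x) :\: K) -> (ncyc ((A :\ x) :\: K) <= p.+1)%N ->
  ~~ odd (#|A| + p.+1) -> bounded p.+1 A.
Proof.
move=> pd N2 Kj bK cR R0 R1 bR nR ev.
have cA := pendant_cardE pd; have le := pendant_even_mu pd N2 Kj bK.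
have evR : ~~ odd (#|(A :\ x) :\: K| + p) by move: ev; rewrite cA Kj; lia.
case: j Kj le => [|j] Kj le.
  apply: (triangle_bounded pd cR R0 Kj N2 bR nR evR); apply: le_trans le _.
  rewrite expr0 mul1r lerD2l ler_nat; exact: pendant_avoiding.
constructor 1; apply: le_lt_trans le _.
have -> : #|A| = (#|(A :\ x) :\: K|.+3 + j.+1.*2)%N by rewrite cA Kj; lia.
have muR := mu_le (leqnn _) nR; rewrite (gbound_same evR) in muR.
have av := rest_avoiding pd cR R0 nR evR.
have av' : (avoiding ((A :\ x) :\: K) (nbrs A x))%:R <=
    lam p * gbound #|(A :\ x) :\: K| p.
  by apply: le_trans av; rewrite ler_nat; exact: pendant_avoiding.
exact: (@even_cycle_inequality _ _ j.+1 _ _ isT evR R1 muR (bounded_le bR) av').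
Qed.

(** The induction on the order: in each case the pieces left by a branching or a
    cut vertex are smaller, and their parities fit the number of cycles that
    remains for them. *)
Theorem connected_bounded A q : conn A -> A != set0 -> (ncyc A <= q.+1)%N ->
  ~~ odd (#|A| + q) -> bounded q A.
Proof.
have [n] := ubnP #|A|; elim: n A q => // n IH A q /ltnSE leA cA A0 nA ev.
have IHlt B p : (#|B| < #|A|)%N -> conn B -> B != set0 -> (ncyc B <= p.+1)%N ->
    ~~ odd (#|B| + p) -> bounded p B.
  by move=> lt; apply: IH; apply: leq_trans lt leA.
have cD1 v : v \in A -> #|A| = #|A :\ v|.+1.
  by move=> vA; rewrite (cardsD1 v A) vA.
have [/exists_inP[v vA /andP[cv d3]]|no3] :=
    boolP [exists v in A, conn (A :\ v) && (2 < #|nbrs A v|)%N].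
  have := ncyc_conn_vertex cv vA; have c1 := cD1 v vA; have ltA := nbrs_lt vA.
  case: q nA ev => [|p] nA ev leC; first by lia.
  apply: (branch_bounded vA d3 _ _ ev); last by lia.
  by apply: IHlt => //; [lia | rewrite -card_gt0; lia | lia | lia].
have deg y : y \in A -> conn (A :\ y) -> (#|nbrs A y| <= 2)%N.
  move=> yA cy; rewrite leqNgt; apply: contra no3 => d3.
  by apply/exists_inP; exists y; rewrite // cy.
have [/exists_inP[v vA ncv]|nocut] := boolP [exists v in A, ~~ conn (A :\ v)]; last first.
  have nc y : y \in A -> conn (A :\ y).
    by move=> yA; apply/negPn; apply: contra nocut => ncy; apply/exists_inP; exists y.
  apply: uncut_bounded => // [y yA|y yA ny oy y0]; first exact: deg (nc y yA).
  by apply: IHlt; rewrite ?ny ?addn0 ?(cD1 y yA) //; apply: nc.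
have [x [K [pd [[cR R0 KR]|no]]]] := pendant_structure cA vA ncv deg; last first.
  exact: unused_bounded pd _ nA ev no.
have cAE := pendant_cardE pd; set R := (A :\ x) :\: K in cR R0 KR cAE.
have RA : R \subset A :\ x := subsetDl _ _.
have nR : (ncyc R <= q.+1)%N.
  by apply: leq_trans nA; apply: ncycS; apply: subset_trans RA (subD1set _ _).
have ltR : (#|R| < #|A|)%N by rewrite cAE ltnS leq_addr.
have [K1|N2] := pendant_leaf_or_cycle pd.
  have evR : ~~ odd (#|R| + q) by move: ev; rewrite cAE K1; lia.
  exact: (leaf_bounded pd cR R0 K1 (IHlt R q ltR cR R0 nR evR) nR evR).
have {}nR : (ncyc R <= q)%N.
  rewrite -ltnS; apply: leq_trans nA; apply: leq_ltn_trans (pendant_cycle pd N2).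
  exact: ncycS.
have KA : K \subset A :\ x by case: pd.
have K2 : (1 < #|K|)%N.
  apply: leq_trans N2 _; apply: subset_leq_card; apply/subsetP => z.
  by rewrite inE => /andP[].
have [[k Kk]|[k Kk]] := parityP #|K|; last first.
  case: k Kk => [|k] Kk; first by move: K2; rewrite Kk.
  exact: odd_cycle_bounded pd N2 Kk nR ev.
case: k Kk => [|k] Kk; first by move: K2; rewrite Kk.
have bK : bounded 0 K.
  apply: IHlt; [by rewrite cAE ltnS leq_addl | by case: pd | | | ].
  - by rewrite -card_gt0 ltnW.
  - by rewrite (pendant_ncyc0 pd).
  - by rewrite Kk addn0 odd_double.
have R2 : (1 < #|R|)%N := leq_trans K2 KR.
case: q nA ev nR => [|p] nA ev nR.
  have R3 : (2 < #|R|)%N by move: ev R2; rewrite cAE Kk; lia.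
  have nR0 : ncyc R = 0 by apply/eqP; rewrite -leqn0.
  by apply: (unicyclic_bounded pd N2 Kk bK cR nR0 R3); rewrite addn0 in ev.
apply: (even_cycle_bounded pd N2 Kk bK cR R0 R2 _ nR ev).
apply: (IHlt R p ltR cR R0 nR); move: ev; rewrite cAE Kk; lia.
Qed.

End ConnectedInduction.

Section ExtremalCycles.
Variable G : sgraph.
Implicit Types (A B C K M R S U W : {set G}) (u v w x y z c r : G).

Lemma cycle_closed (s : seq G) (P : pred G) x : uniq s -> x \in s -> P x ->
  (forall y, y \in s -> P y -> P (next s y)) -> {in s, forall y, P y}.
Proof.
move=> us xs Px HP; have [i s' Es] := rot_to xs.
have fc : fcycle (next s) (x :: s') by rewrite -Es rot_cycle cycle_next.
have sub : {subset x :: s' <= s} by move=> y; rewrite -Es mem_rot.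
suff H y : y \in x :: s' -> P y by move=> y ys; apply: H; rewrite -Es mem_rot.
move: fc => /=; rewrite rcons_path => /andP[pth _].
elim: s' x Px {xs Es} sub pth y => [|z s' IH] x Px sub.
  by move=> _ y; rewrite inE => /eqP->.
move=> /= /andP[/eqP xz pth] y; rewrite inE => /orP[/eqP->//|].
apply: IH => //; last by move=> t ts; apply: sub; rewrite inE ts orbT.
by rewrite -xz HP // sub // mem_head.
Qed.

(** A cycle that crossed the bridge between [c] and [r] would cross it twice,
    and consist of this edge alone. *)
Lemma hung_cycles c r A K : hung c r A K -> ncyc (A :|: K) <= ncyc A + ncyc K.
Proof.
move=> [dis cA rK clK e]; apply: leq_trans (leq_card_setU _ _).
apply/subset_leq_card/subsetP => F /cycles_inP[s [s2 us sub ->]].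
have [cyc uniqs] := andP us.
have stays (X Y : {set G}) a b : (forall x y, x \in X -> y \in Y -> edge x y -> x = a /\ y = b) ->
  A :|: K \subset X :|: Y -> [disjoint X & Y] -> 
  (exists2 x, x \in s & x \in X) -> (exists2 y, y \in s & y \in Y) ->
  a \in s /\ next s a = b.
  move=> XY cov disXY [x xs xX] [y ys yY].
  have [/existsP[z /and3P[zs zX nz]]|no] := boolP [exists z, [&& z \in s, z \in X & next s z \notin X]].
    have nY : next s z \in Y.
      have := subsetP cov (next s z); rewrite (sub _ _) ?mem_next // => /(_ isT).
      by rewrite inE (negPf nz).
    by have [<- <-] := XY _ _ zX nY (next_cycle cyc zs).
  have /(_ y ys) : {in s, forall y, y \in X}.
    apply: (cycle_closed (x := x) uniqs xs xX) => z zs zX; apply: contraNT no => nz.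
    by apply/existsP; exists z; apply/and3P; split.
  by rewrite (disjointFl disXY yY).
have AK x y : x \in A -> y \in K -> edge x y -> x = c /\ y = r.
  by move=> xA yK; rewrite e // => /andP[/eqP-> /eqP->].
have KA x y : x \in K -> y \in A -> edge x y -> x = r /\ y = c.
  by move=> xK yA; rewrite edge_sym => /(AK _ _ yA xK)[-> ->].
have [/hasP[x xs xA]|noA] := boolP (has (mem A) s); last first.
  rewrite inE; apply/orP; right; apply/cycles_inP; exists s; split=> // x xs.
  have := sub x xs; rewrite inE => /orP[xA|//].
  by case/negP: noA; apply/hasP; exists x.
have [/hasP[y ys yK]|noK] := boolP (has (mem K) s); last first.
  rewrite inE; apply/orP; left; apply/cycles_inP; exists s; split=> // z zs.
  have := sub z zs; rewrite inE => /orP[//|zK].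
  by case/negP: noK; apply/hasP; exists z.
have [] := stays A K c r AK (subxx _) dis; [by exists x | by exists y |].
have [] := stays K A r c KA; rewrite 1?setUC 1?disjoint_sym //; [by exists y | by exists x |].
move=> rs nr cs nc; exfalso.
have : {in s, forall z, z \in [:: c; r]}.
  apply: (cycle_closed (x := c) uniqs cs); first by rewrite mem_head.
  by move=> z zs; rewrite !inE => /orP[]/eqP->; rewrite ?nc ?nr eqxx ?orbT.
by move/(uniq_leq_size uniqs); rewrite leqNgt s2.
Qed.

Lemma ncyc_small K : #|K| <= 2 -> ncyc K = 0.
Proof.
move=> K2; apply/eqP; rewrite cards_eq0; apply/eqP/setP => F; rewrite in_set0.
apply/negP => /cycles_inP[s [s2 /andP[_ us] sub _]].
have : size s <= #|K|.
  by rewrite cardE; apply: uniq_leq_size us _ => x /sub; rewrite mem_enum.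
lia.
Qed.

Lemma ncyc_triple K : #|K| = 3 -> ncyc K <= 1.
Proof.
move=> K3; suff H F : F \in cycles_in K -> F = [set K :\ z | z in K].
  rewrite /ncyc; apply: leq_trans (_ : #|[set [set K :\ z | z in K]]| <= 1).
    by apply/subset_leq_card/subsetP => F /H->; rewrite set11.
  by rewrite cards1.
case/cycles_inP=> s [s2 us sub ->]; have [cyc uniqs] := andP us.
have sK : s =i K.
  have [] := @uniq_min_size _ s (enum K) uniqs.
  - by move=> x /sub; rewrite mem_enum.
  - by rewrite -cardE K3.
  by move=> _ E x; rewrite E mem_enum.
have edgeE x : x \in s -> [set x; next s x] = K :\ prev s x.
  move=> xs; have px : prev s x != x.
    by apply: contraTneq (prev_cycle cyc xs) => ->; rewrite edge_irrefl.
  have nx : x != next s x.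
    by apply: contraTneq (next_cycle cyc xs) => <-; rewrite edge_irrefl.
  apply/eqP; rewrite eqEcard cards2 nx; apply/andP; split; last first.
    by have := cardsD1 (prev s x) K; rewrite -sK mem_prev xs K3; lia.
  rewrite subUset !sub1set !inE -!sK mem_next xs eq_sym px.
  by rewrite next_neq_prev.
apply/setP => e; apply/imsetP/imsetP => [[x xs ->]|[z zK ->]].
  by exists (prev s x); rewrite ?edgeE // -sK mem_prev.
exists (next s z); first by rewrite mem_next sK.
by rewrite edgeE ?mem_next ?sK // prev_next.
Qed.

Lemma extremal_ncyc q c A : extremal q c A -> ncyc A <= q.
Proof.
elim=> {q c A} [q c A q1 _ _ cA|q i c r A K i1 _ _ IH hg cK].
  case: q q1 cA => [|[|q]] // _ cA; last exact: ncyc_triple.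
  by rewrite ncyc_small ?cA.
apply: leq_trans (hung_cycles hg) (leq_add IH _).
case: i i1 cK => [|[|i]] // _ cK; last exact: ncyc_triple.
by rewrite ncyc_small ?cK.
Qed.

End ExtremalCycles.

(** * Uniqueness of the extremal graph *)

Section Peeling.
Variable G : sgraph.
Implicit Types (A B C K M R S U W : {set G}) (u v w x y z c r : G).

Definition extremal_order q := if q == 0 then 2 else 3 * q.

Lemma extremal_order_le q c A : extremal q c A -> extremal_order q <= #|A|.
Proof.
rewrite /extremal_order.
elim=> {q c A} [q c A q1 _ _ ->|q i c r A K i1 iq _ IH hg cK].
  by case: q q1 => [|[|q]].
rewrite (hung_cardU hg) cK; move: IH; case: eqP; case: eqP; lia.
Qed.

Lemma hung_sub c r A A' K : hung c r A K -> A' \subset A -> c \in A' -> hung c r A' K.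
Proof.
case=> dis cA rK clK e /subsetP sub cA'; split=> //.
  by apply: disjointWl dis; apply/subsetP.
by move=> a k /sub aA; apply: e.
Qed.

Lemma hung_exchange c r r' A K K' : hung c r A K -> hung c r' (A :|: K) K' ->
  hung c r (A :|: K') K.
Proof.
case=> dis cA rK clK e [dis' _ r'K' clK' e']; split=> //.
- have dAK' : [disjoint K & K'] by apply: disjointWl dis'; apply: subsetUr.
  by rewrite disjoints_subset subUset -!disjoints_subset dis disjoint_sym.
- by rewrite inE cA.
move=> a k aA kK; have kA : k \notin A by rewrite (disjointFl dis kK).
move: aA; rewrite inE => /orP[aA|aK']; first exact: e.
rewrite edge_sym e' ?inE ?kK ?orbT //.
have -> : (k == c) = false by apply: contraNF kA => /eqP->.
have aA : a \notin A :|: K by rewrite (disjointFl dis' aK').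
by symmetry; apply/negbTE; apply: contra aA => /andP[/eqP-> _]; rewrite inE cA.
Qed.

(** The order in which the cliques are hung does not matter: any size that
    occurs can be peeled off last. *)
Lemma extremal_peel q d B i : extremal q d B -> i <= 1 ->
  (i = 0 -> extremal_order q < #|B|) -> (i = 1 -> 1 < q) ->
  exists r B' K, [/\ B = B' :|: K, extremal (q - i) d B', hung d r B' K & #|K| = i.+2].
Proof.
move=> ext i1; elim: ext => {q d B} [q c A q1 cA clA cardA h0 h1|q j c r A K j1 jq ext IH hg cK h0 h1].
  exfalso; case: i i1 h0 h1 => [|[|i]] // _ h0 h1; last by move: (h1 erefl); lia.
  by move: (h0 erefl); rewrite cardA; case: q q1 {cA clA cardA h0 h1} => [|[|q]].
have [ij|ij] := eqVneq i j.
  by exists r, A, K; rewrite ij addnK -ij in cK *; split.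
have cAK := hung_cardU hg.
have [||r' [A' [K' [EA ext' hg' cK']]]] := IH.
- move=> i0; have j1' : j = 1 by lia.
  by have := h0 i0; rewrite cAK cK j1' /extremal_order; case: eqP; case: eqP; lia.
- by move=> i1'; have := h1 i1'; lia.
have cA' := extremal_center ext'.
have hgr : hung c r A' K by apply: hung_sub hg _ cA'; rewrite EA subsetUl.
exists r', (A' :|: K), K'; split=> //.
- by rewrite EA setUAC.
- have -> : q + j - i = q - i + j.
    by case: i i1 ij h1 {h0 IH cK' ext'} => [|[|i]] // _ ij h1; have := h1; lia.
  apply: ExtremalHang ext' hgr cK => //.
  by case: i i1 ij h1 {h0 IH cK'} => [|[|i]] // _ ij h1; have := h1; lia.
- by rewrite EA in hg; apply: hung_exchange hg' hg.
Qed.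

End Peeling.

Lemma card_bijection (T T' : finType) (X : {set T}) (Y : {set T'}) x0 y0 :
  x0 \in X -> y0 \in Y -> #|X| = #|Y| ->
  exists f : T -> T', [/\ f x0 = y0, {in X &, injective f} & f @: X = Y].
Proof.
move=> xX yY cXY; pose s := x0 :: enum (X :\ x0); pose s' := y0 :: enum (Y :\ y0).
have us : uniq s by rewrite /= enum_uniq mem_enum !inE eqxx.
have us' : uniq s' by rewrite /= enum_uniq mem_enum !inE eqxx.
have sX : s =i X by move=> z; rewrite inE mem_enum !inE; case: eqP => [->|].
have sY : s' =i Y by move=> z; rewrite inE mem_enum !inE; case: eqP => [->|].
have ss : size s = size s'.
  by rewrite /= -!cardE; move: cXY; rewrite (cardsD1 x0) xX (cardsD1 y0 Y) yY; lia.
pose f x := nth y0 s' (index x s).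
have fY x : x \in X -> f x \in Y.
  by rewrite -sX -sY => xs; apply: mem_nth; rewrite -ss index_mem.
have inj : {in X &, injective f}.
  move=> x y; rewrite -!sX => xs ys /eqP; rewrite nth_uniq -?ss ?index_mem //.
  by move=> /eqP E; rewrite -(nth_index x0 xs) E nth_index.
exists f; split=> //; first by rewrite /f /= eqxx.
apply/eqP; rewrite eqEcard (card_in_imset inj) cXY leqnn andbT.
by apply/subsetP => _ /imsetP[x xX' ->]; apply: fY.
Qed.

(** A clique of the size hung last on the first graph is peeled off the second
    one; what remains is matched by induction, centre to centre. *)
Theorem extremal_unique (G H : sgraph) q c d (A : {set G}) (B : {set H}) :
  extremal q c A -> extremal q d B -> #|A| = #|B| ->
  exists f : G -> H, [/\ f c = d, {in A &, injective f}, f @: A = B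
    & {in A &, forall x y, edge (f x) (f y) = edge x y}].
Proof.
move=> extA; elim: extA d B => {q c A} [q c A q1 cA clA cardA|q i c r A K i1 iq ext IH hg cK] d B extB cAB.
  have clB : clique B.
    case: extB q1 cAB cardA => // q0 j {}d r' B' K' j1 jq extB' hg' cK' q1 cAB cardA.
    have := extremal_order_le extB'; move: cAB; rewrite (hung_cardU hg') cK' cardA.
    by rewrite /extremal_order; case: eqP; lia.
  have [f [fc inj im]] := card_bijection cA (extremal_center extB) cAB.
  exists f; split=> // x y xA yA.
  by rewrite clA // clB -?im ?imset_f // (inj_in_eq inj).
have cAK := hung_cardU hg.
have [||r' [B' [K' [EB extB' hg' cK']]]] := extremal_peel extB i1.
- move=> i0; rewrite -cAB cAK cK i0 addn0.
  by have := extremal_order_le ext; lia.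
- lia.
rewrite addnK in extB'.
have cAB' : #|A| = #|B'|.
  by have := hung_cardU hg'; rewrite -EB -cAB cAK cK cK'; lia.
have [f [fc inj im ed]] := IH d B' extB' cAB'.
have [dis cA rK clK e] := hg; have [dis' dB' rK' clK' e'] := hg'.
have [g [gr ginj gim]] := card_bijection rK rK' (etrans cK (esym cK')).
pose h x := if x \in A then f x else g x.
have hA x : x \in A -> h x = f x by rewrite /h => ->.
have hK x : x \in K -> h x = g x by rewrite /h => xK; rewrite (disjointFl dis xK).
have fB x : x \in A -> f x \in B' by move=> xA; rewrite -im imset_f.
have gK x : x \in K -> g x \in K' by move=> xK; rewrite -gim imset_f.
have neq x y : x \in A -> y \in K -> f x != g y.
  by move=> xA yK; apply: contraTneq (gK y yK) => <-; rewrite (disjointFr dis' (fB x xA)).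
have cross x y : x \in A -> y \in K -> edge (f x) (g y) = edge x y.
  move=> xA yK; rewrite e // e' ?fB ?gK //; congr andb.
    by rewrite -fc (inj_in_eq inj).
  by rewrite -gr (inj_in_eq ginj).
exists h; split.
- by rewrite hA.
- move=> x y; rewrite !inE => /orP[xA|xK] /orP[yA|yK]; rewrite ?(hA _ xA) ?(hK _ xK) ?(hA _ yA) ?(hK _ yK).
  + exact: inj.
  + by move=> E; have := neq x y xA yK; rewrite E eqxx.
  + by move=> E; have := neq y x yA xK; rewrite E eqxx.
  + exact: ginj.
- by rewrite imsetU EB -im -gim; congr (_ :|: _); apply: eq_in_imset => x; [apply: hA|apply: hK].
- move=> x y; rewrite !inE => /orP[xA|xK] /orP[yA|yK]; rewrite ?(hA _ xA) ?(hK _ xK) ?(hA _ yA) ?(hK _ yK).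
  + exact: ed.
  + exact: cross.
  + by rewrite edge_sym cross // edge_sym.
  + by rewrite clK // clK' ?gK // (inj_in_eq ginj).
Qed.

(** * The graphs C(n, q) *)

Section Roots.
Variable H : sgraph.
Implicit Types (C : {set H}) (x y : H).

Definition isolated_clique C :=
  clique C /\ forall x y, x \in C -> edge x y -> y \in C.

(** Which vertex of a component is its representative is not known, but in a
    clique all choices are alike. *)
Lemma isolated_clique_root C : isolated_clique C -> C != set0 ->
  exists2 r, r \in C & {in C, forall x, roots (@edge H) x = (x == r)}.
Proof.
move=> [clC isoC] /set0Pn[x xC].
have sym : connect_sym (@edge H) by apply: sym_connect_sym; apply: edge_sym.
have con y z : y \in C -> connect (@edge H) y z -> z \in C.
  move=> yC /connectP[p pth ->]; elim: p y yC pth => //= t p IH y yC /andP[yt].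
  by apply: IH; apply: isoC yt.
exists (fingraph.root (@edge H) x); first exact: con xC (connect_root _ _).
move=> y yC; have xy : connect (@edge H) x y.
  have [->|xy] := eqVneq x y; first exact: connect0.
  by apply: connect1; rewrite clC.
by rewrite /roots (fingraph.rootP sym xy) eq_sym.
Qed.

End Roots.

Section StarOfCliques.
Variables (m : nat) (H : sgraph).
Notation S := (star m.+1 H).
Notation v0 := (inl ord0 : S).
Notation part C := [set (inr x : S) | x in C].

Lemma star_hung (A : {set S}) (C : {set H}) : isolated_clique C -> C != set0 ->
  v0 \in A -> [disjoint A & part C] -> exists r, hung v0 r A (part C).
Proof.
move=> iC C0 vA dis; have [r rC rootE] := isolated_clique_root iC C0.
have [clC isoC] := iC; exists (inr r); split=> //.
- exact: imset_f.
- move=> _ _ /imsetP[x xC ->] /imsetP[y yC ->].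
  have -> : (inr x != inr y :> S) = (x != y) by [].
  exact: clC.
move=> [i|y] _ aA /imsetP[x xC ->]; rewrite /edge /= -?/(edge _ _).
  by rewrite rootE //; congr andb; apply/eqP/eqP => [i0|[->]//]; congr inl; apply: val_inj.
apply/negbTE/negP => yx; have yC : y \in C by apply: isoC xC _; rewrite edge_sym.
by have := disjointFr dis aA; rewrite imset_f.
Qed.

Lemma star_hang_family q i t (C : 'I_t -> {set H}) (A : {set S}) : i <= 1 -> i <= q ->
  extremal q v0 A -> (forall k, isolated_clique (C k)) -> (forall k, #|C k| = i.+2) ->
  (forall k, [disjoint A & part (C k)]) ->
  (forall k l, k != l -> [disjoint C k & C l]) ->
  extremal (q + t * i) v0 (A :|: part (\bigcup_k C k)).
Proof.
move=> i1 iq ext iC cC disA disC; have v0A := extremal_center ext.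
suff HP (P : {set 'I_t}) : extremal (q + #|P| * i) v0 (A :|: part (\bigcup_(k in P) C k)).
  have := HP [set: 'I_t]; rewrite cardsT card_ord.
  by rewrite (eq_bigl xpredT) // => k; rewrite inE.
have [s] := ubnP #|P|; elim: s P => // s IH P /ltnSE leP.
have [->|/set0Pn[k kP]] := eqVneq P set0.
  rewrite cards0 addn0 big_pred0 => [|l]; last by rewrite inE.
  by rewrite imset0 setU0.
have cP : #|P| = #|P :\ k|.+1 by rewrite (cardsD1 k P) kP.
have disB : [disjoint A :|: part (\bigcup_(l in P :\ k) C l) & part (C k)].
  rewrite disjoints_subset subUset -!disjoints_subset disA /=.
  rewrite disjoints_subset; apply/subsetP => _ /imsetP[x /bigcupP[l lP xl] ->].
  move: lP; rewrite !inE => /andP[lk _]; apply/negP => /imsetP[y yk [xy]].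
  by rewrite -xy in yk; rewrite (disjointFr (disC l k lk) xl) in yk.
have ltk : #|P :\ k| < s by rewrite -cP.
have IHk := IH (P :\ k) ltk.
have Ck0 : C k != set0 by rewrite -card_gt0 cC.
have [r hg] := star_hung (iC k) Ck0 (subsetP (subsetUl _ _) _ v0A) disB.
have -> : q + #|P| * i = q + #|P :\ k| * i + i by rewrite cP mulSn (addnC i) addnA.
have -> : A :|: part (\bigcup_(l in P) C l) =
    (A :|: part (\bigcup_(l in P :\ k) C l)) :|: part (C k).
  by rewrite (big_setD1 k kP) /= imsetU setUCA setUC.
apply: ExtremalHang i1 _ IHk hg _; first exact: leq_trans iq (leq_addr _ _).
by rewrite card_imset ?cC //; apply: inr_inj.
Qed.

End StarOfCliques.

Definition layer (s t : nat) (k : 'I_t) : {set copies t (complete s)} := [set u | u.1 == k].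

Lemma layer_isolated s t k : isolated_clique (@layer s t k).
Proof.
split=> [[k1 a] [k2 b]|[k1 a] [k2 b]]; rewrite !inE /= /edge /= /copies_edge /=.
  by move=> /eqP-> /eqP->; rewrite eqxx /edge /= /complete_edge xpair_eqE eqxx.
by move=> /eqP-> /andP[/eqP<-].
Qed.

Lemma card_layer s t k : #|@layer s t k| = s.
Proof.
rewrite -[RHS]card_ord -(card_imset (f := fun j => (k, j) : copies t (complete s))).
  apply: eq_card => -[k1 a]; rewrite inE /=.
  apply/eqP/imsetP => [->|[j _ [->]]//]; by exists a.
by move=> a b [].
Qed.

Lemma layer_disjoint s t k l : k != l -> [disjoint @layer s t k & @layer s t l].
Proof.
move=> kl; rewrite disjoint_subset; apply/subsetP => u; rewrite !inE => /eqP->.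
by apply: contra kl => /eqP->.
Qed.

Section DisjointUnion.
Variables H1 H2 : sgraph.
Notation U := (disjoint_union H1 H2).

Lemma isolated_inl (C : {set H1}) : isolated_clique C ->
  isolated_clique [set (inl x : U) | x in C].
Proof.
case=> clC isoC; split.
  by move=> _ _ /imsetP[x xC ->] /imsetP[y yC ->]; apply: clC.
move=> _ [y|y] /imsetP[x xC ->] // xy; apply: imset_f; exact: isoC xC xy.
Qed.

Lemma isolated_inr (C : {set H2}) : isolated_clique C ->
  isolated_clique [set (inr x : U) | x in C].
Proof.
case=> clC isoC; split.
  by move=> _ _ /imsetP[x xC ->] /imsetP[y yC ->]; apply: clC.
move=> _ [y|y] /imsetP[x xC ->] // xy; apply: imset_f; exact: isoC xC xy.
Qed.

End DisjointUnion.

Lemma disjoint_imset (T T' : finType) (f : T -> T') (X Y : {set T}) : injective f ->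
  [disjoint X & Y] -> [disjoint f @: X & f @: Y].
Proof.
move=> inj dis; rewrite disjoint_subset; apply/subsetP => _ /imsetP[x xX ->].
by rewrite inE mem_imset // (disjointFr dis xX).
Qed.

Lemma disjoint_images (T1 T2 T : finType) (f : T1 -> T) (g : T2 -> T)
  (X : {pred T1}) (Y : {pred T2}) : (forall x y, f x != g y) ->
  [disjoint [set f x | x in X] & [set g y | y in Y]].
Proof.
move=> fg; rewrite disjoint_subset; apply/subsetP => _ /imsetP[x _ ->].
by rewrite inE; apply/imsetP => -[y _ /eqP]; apply/negP.
Qed.

Lemma extremal_graph_extremal n q : ~~ odd (n + q) -> extremal_order q <= n ->
  exists c : extremal_graph n q, extremal q c [set: extremal_graph n q].
Proof.
rewrite /extremal_graph /extremal_order; case: eqP => [->|/eqP q0] ev le.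
  set H := disjoint_union _ _; pose A : {set star 1 H} := [set inl ord0; inr (inl ord0)].
  have iso0 : isolated_clique [set (inl ord0 : H)].
    split=> [x y /set1P-> /set1P->|x [j|y] /set1P->]; rewrite ?edge_irrefl ?eqxx //.
    by move=> _; rewrite inE [j]ord1.
  have r0 : roots (@edge H) (inl ord0).
    have C0 : [set (inl ord0 : H)] != set0 by apply/set0Pn; exists (inl ord0); rewrite inE.
    by have [r /set1P-> ->] := isolated_clique_root iso0 C0; rewrite ?inE.
  have extA : extremal 0 (inl ord0 : star 1 H) A.
    apply: ExtremalBase; rewrite ?set21 ?cards2 //.
    by move=> x y /set2P[]-> /set2P[]->; rewrite ?edge_irrefl ?eqxx // /edge /= r0.
  exists (inl ord0 : star 1 H).
  have := star_hang_family (i := 0) (q := 0) (t := (n - 2) %/ 2) (m := 0) (H := H)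
    (C := fun k => [set (inr x : H) | x in layer 2 k]) isT isT extA.
  rewrite muln0; set F := _ :|: _; have -> : F = setT.
    apply/setP => -[i|[j|[k a]]]; rewrite !inE.
    - by rewrite [i]ord1 eqxx.
    - by rewrite [j]ord1 eqxx orbT.
    - apply/orP; right; apply: imset_f; apply/bigcupP; exists k => //.
      by apply: imset_f; rewrite inE.
  apply.
  - by move=> k; apply: isolated_inr; apply: layer_isolated.
  - by move=> k; rewrite card_imset ?card_layer //; apply: inr_inj.
  - move=> k; rewrite disjoint_subset; apply/subsetP => _ /set2P[]->; rewrite inE.
      by apply/imsetP => -[].
    by apply/imsetP => -[y /imsetP[z _ ->]].
  - by move=> k l kl; apply: disjoint_imset; [apply: inr_inj | apply: layer_disjoint].
set H := disjoint_union _ _; pose A : {set star 3 H} := [set (inl i : star 3 H) | i in 'I_3].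
have extA : extremal 1 (inl ord0 : star 3 H) A.
  apply: ExtremalBase; rewrite ?imset_f //.
    by move=> _ _ /imsetP[i _ ->] /imsetP[j _ ->].
  by rewrite card_imset ?card_ord //; apply: inl_inj.
exists (inl ord0 : star 3 H).
have ext1 := star_hang_family (i := 1) (q := 1) (t := q - 1) (m := 2) (H := H)
    (C := fun k => [set (inl x : H) | x in layer 3 k]) isT isT extA.
set B := A :|: _ in ext1.
have {}ext1 : extremal q (inl ord0 : star 3 H) B.
  have -> : q = 1 + (q - 1) * 1 by rewrite muln1 subnKC // lt0n.
  apply: ext1.
  - by move=> k; apply: isolated_inl; apply: layer_isolated.
  - by move=> k; rewrite card_imset ?card_layer //; apply: inl_inj.
  - by move=> k; apply: disjoint_images.
  - by move=> k l kl; apply: disjoint_imset; [apply: inl_inj | apply: layer_disjoint].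
have := star_hang_family (i := 0) (q := q) (t := (n - 3 * q) %/ 2) (m := 2) (H := H)
    (C := fun k => [set (inr x : H) | x in layer 2 k]) isT isT ext1.
rewrite muln0 addn0; set F := _ :|: _; have -> : F = setT.
  apply/setP => -[i|[[k a]|[k a]]]; rewrite !inE.
  - by rewrite imset_f.
  - apply/orP; left; apply/orP; right; apply: imset_f; apply/bigcupP; exists k => //.
    by apply: imset_f; rewrite inE.
  - apply/orP; right; apply: imset_f; apply/bigcupP; exists k => //.
    by apply: imset_f; rewrite inE.
apply.
- by move=> k; apply: isolated_inr; apply: layer_isolated.
- by move=> k; rewrite card_imset ?card_layer //; apply: inr_inj.
- move=> k; rewrite disjoints_subset subUset -!disjoints_subset.
  apply/andP; split; first exact: disjoint_images.
  apply: disjoint_imset; first exact: inr_inj.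
  rewrite disjoint_subset; apply/subsetP => x /bigcupP[l _ /imsetP[y _ ->]].
  by rewrite inE; apply/imsetP => -[].
- by move=> k l kl; apply: disjoint_imset; [apply: inr_inj | apply: layer_disjoint].
Qed.

Lemma card_extremal_graph n q : ~~ odd (n + q) -> extremal_order q <= n ->
  #|extremal_graph n q| = n.
Proof.
rewrite /extremal_graph /extremal_order; case: eqP => [->|/eqP q0] ev le.
  by rewrite !card_sum card_prod !card_ord; lia.
by rewrite !card_sum !card_prod !card_ord; lia.
Qed.

Lemma num_mis_isomorphic (G H : sgraph) : isomorphic G H -> num_mis G = num_mis H.
Proof.
have le (G1 H1 : sgraph) (f : G1 -> H1) (g : H1 -> G1) : cancel f g -> cancel g f ->
    (forall x y, edge (f x) (f y) = edge x y) -> mu [set: G1] <= mu [set: H1].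
  move=> fK gK e; have fI := can_inj fK; have gI := can_inj gK.
  have e' x y : edge (g x) (g y) = edge x y by rewrite -e !gK.
  have indf (S : {set G1}) : independent S -> independent (f @: S).
    move=> /independentP I; apply/independentP => _ _ /imsetP[x xS ->] /imsetP[y yS ->].
    by rewrite e; apply: I.
  have indg (S : {set H1}) : independent S -> independent (g @: S).
    move=> /independentP I; apply/independentP => _ _ /imsetP[x xS ->] /imsetP[y yS ->].
    by rewrite e'; apply: I.
  rewrite /mu -(card_imset _ (imset_inj fI)); apply/subset_leq_card/subsetP.
  move=> _ /imsetP[S /misP[I _ mx] ->]; apply/misP; split; rewrite ?subsetT ?indf //.
  by move=> S' I' _; rewrite card_imset // -(card_imset _ gI); apply: mx; rewrite ?subsetT ?indg.
case=> f [g fK gK] e; rewrite !num_misE; apply/eqP; rewrite eqn_leq.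
rewrite (le _ _ f g) // (le _ _ g f) // => x y.
by rewrite -e !gK.
Qed.

(** * Values of the bound *)

Section Values.
Local Open Scope ring_scope.

Lemma gbound_triangles q : gbound (3 * q) q = 3 ^+ q.
Proof.
elim: q => [|q IH]; first by rewrite muln0 (gbound0_even 0).
have -> : (3 * q.+1 = (3 * q).+1.+2)%N by lia.
have ev : ~~ odd (3 * q + q) by lia.
rewrite gboundSS (gbound_diag ev) IH.
by rewrite exprS mulrA; congr (_ * _); lra.
Qed.

Lemma hbound_extremal_count n q : ~~ odd (n + q) -> (extremal_order q <= n)%N ->
  hbound n q = (extremal_count n q)%:R.
Proof.
rewrite /extremal_order /extremal_count; case: q => [|q] /= ev le.
  have {1}-> : n = (((n - 2) %/ 2).*2.+2)%N by lia.
  by rewrite hbound0_even natrD natrX.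
have [t En] : exists t, n = (3 * q.+1 + t.*2)%N by exists ((n - 3 * q.+1)./2); lia.
have -> : ((n - 3 * q.+1 + 2) %/ 2 = t.+1)%N by lia.
rewrite En /hbound gbound_double gbound_triangles /lam /eps /= subn1 /=.
by rewrite natrD natrM !natrX !exprS; lra.
Qed.

(** The bound for [q - 2] is smaller than that for [q], and a tree of odd order
    reaches at most half of [gbound]. *)
Lemma few_cycles_strict (G : sgraph) (A : {set G}) q : conn A -> A != set0 ->
  (2 < #|A|)%N -> (ncyc A < q)%N -> ~~ odd (#|A| + q) -> (mu A)%:R < hbound #|A| q.
Proof.
move=> cA A0 A3; case: q => [|[|q]] // lt ev.
  have n0 : ncyc A = 0%N by lia.
  have oA : odd #|A| by lia.
  have := odd_tree cA n0 oA A3; have := gbound_monoS #|A| 0.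
  have := gbound_gt0 #|A| 1; rewrite /hbound /lam /eps /=; lra.
apply: le_lt_trans (hboundSS _ _); apply: bounded_le.
by apply: connected_bounded => //; lia.
Qed.

End Values.

Lemma connected_conn (G : sgraph) : connected G -> conn [set: G].
Proof.
move=> con; apply/forall_inP => x _; apply/forall_inP => y _.
rewrite (@eq_connect _ _ (@edge G)) //.
by move=> a b; rewrite /edge_in !inE.
Qed.

Theorem theorem3p4 (r n : nat) (G : sgraph)
    (hr : 1 <= r) (hn : 3 * r <= n) (hpar : n != r %[mod 2])
    (hcard : #|G| = n) (hconn : connected G) (hcyc : num_cycles G <= r) :
  [/\ num_mis G <= extremal_count n (r - 1),
      (num_mis G = extremal_count n (r - 1) -> num_cycles G = r - 1)
    & (num_mis G = extremal_count n (r - 1) <->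
       isomorphic G (extremal_graph n (r - 1)))].
Proof.
have [q Er] : exists q, r = q.+1 by exists r.-1; rewrite prednK.
subst r; rewrite subn1 /=.
have ev : ~~ odd (n + q) by lia.
have ord : extremal_order q <= n by rewrite /extremal_order; case: eqP; lia.
have cG := connected_conn hconn; have card : #|[set: G]| = n by rewrite cardsT.
have G0 : [set: G] != set0 by rewrite -card_gt0 card; lia.
have hE := hbound_extremal_count ev ord.
have bG : bounded q [set: G].
  by apply: connected_bounded; rewrite ?card // -num_cyclesE.
have ext : num_mis G = extremal_count n q -> exists c : G, extremal q c [set: G].
  move=> eq; case: bG => [|c ec|q1 n5]; first 1 last.
  - by exists c.
  - by move: hn; rewrite -card n5 q1.
  by rewrite card hE -num_misE eq ltxx.
split.
- by rewrite -(ler_nat rat) -hE num_misE -card; apply: bounded_le.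
- move=> eq; have [c ec] := ext eq; apply/eqP; rewrite eqn_leq num_cyclesE.
  rewrite (extremal_ncyc ec) leqNgt; apply/negP => lt.
  have := few_cycles_strict cG G0 _ lt; rewrite card hE -num_misE eq ltxx.
  by move=> H; suff: false by []; apply: H => //; lia.
split=> [eq|iso].
- have [c ec] := ext eq; have [d ed] := extremal_graph_extremal ev ord.
  have cEG : #|[set: extremal_graph n q]| = n by rewrite cardsT card_extremal_graph.
  have [f [_ inj _ e]] := extremal_unique ec ed (etrans card (esym cEG)).
  exists f => [|x y]; last by rewrite e ?inE.
  apply: inj_card_bij; last by rewrite card_extremal_graph // hcard.
  by move=> x y; apply: inj; rewrite inE.
- rewrite (num_mis_isomorphic iso) num_misE.
  have [d /extremal_mu] := extremal_graph_extremal ev ord.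
  by rewrite cardsT card_extremal_graph // hE => /eqP; rewrite (eqr_nat rat) => /eqP.
Qed.
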